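(* The metric space $(S,d_S)$ of continuous real functions on finite intervals vanishing at $0$ (as defined in the context) is a thick real tree and a homogeneous metric space. Moreover, $S$ is an asymptotic subcone of the hyperbolic plane.
   Context: The space $S$: the elements of $S$ are all continuous real-valued functions $f$ defined on a finite interval $[0,\rho]$, $0\le\rho<\infty$ (each function has its own $\rho$), such that $f(0)=0$. For $f_1,f_2\in S$ with domains $[0,\rho_1]$, $[0,\rho_2]$, the moment of segregation is $s=\sup\{t : f_1(t')=f_2(t') \text{ for all } t'<t\}$, where $t\in[0,\min(\rho_1,\rho_2)]$ and $t'\in[0,t)$, and the metric is $d_S(f_1,f_2)=(\rho_1-s)+(\rho_2-s)$. Geodesic segments and geodesic spaces: for points $x_0,x_1$ of a metric space $X$ with $a=d_X(x_0,x_1)$, a geodesic segment connecting $x_0$ and $x_1$ is an isometric (distance-preserving) map $g:[0,a]\to X$ with $g(0)=x_0$, $g(a)=x_1$; its image is also called a geodesic segment. $X$ is geodesic if every two of its points are connected by a (not necessarily unique) geodesic segment. Real tree: a metric space $X$ such that (1) for every two distinct points there is a unique geodesic segment joining them, and (2) if two geodesic segments $[a,b]$ and $[b,c]$ have exactly the one point $b$ (a common endpoint) in common, then their union is also a geodesic segment. Real tree with countably many vertices: a real tree $T$ for which there is a countable (finite or infinite) set $V\subset T$, the set of vertices, such that $T$ is the union of the geodesic segments joining pairs of points of $V$. Thick: a real tree is thick if every real tree with countably many vertices admits an isometric (distance-preserving, not necessarily surjective) inclusion into it. Homogeneous: a metric space is homogeneous if for every two of its points there is a one-to-one isometry of the space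 onto itself moving the first point to the second. Isometric embedding at infinity: let $(X,d_X)$ be a metric space of infinite diameter. A metric space $(T,d_T)$ can be isometrically embedded at infinity into $X$ if there are a fixed sequence of positive numbers $\varepsilon_i\to 0$ and, for every $t\in T$, an infinite sequence $\{x_t^i\}_{i=1,2,\dots}$ of points of $X$ such that $\lim_{i\to\infty}\varepsilon_i\, d_X(x_{t_1}^i,x_{t_2}^i)=d_T(t_1,t_2)$ for every $t_1,t_2\in T$. Asymptotic subcone: a metric space $X_0$ is an asymptotic subcone of $X$ if $X_0$ is geodesic and every finite subset of $X_0$ (with the induced metric) can be isometrically embedded at infinity into $X$ (the sequence $\varepsilon_i$ may depend on the finite subset). Hyperbolic plane: the unit disc $\{x\in\mathbb{C}: |x|<1\}$ with the distance $d_X(x_1,x_2)=\ln\frac{|1-x_1\overline{x_2}|+|x_1-x_2|}{|1-x_1\overline{x_2}|-|x_1-x_2|}$. *)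

(* Defs.v *)
From HB Require Import structures.
From mathcomp Require Import all_boot all_order all_algebra.
From mathcomp Require Import all_classical all_reals all_analysis.
From mathcomp Require Import complex.
From mathcomp Require Import ring lra.

Set Implicit Arguments.
Unset Strict Implicit.
Unset Printing Implicit Defensive.

Import Order.TTheory GRing.Theory Num.Theory.
Import numFieldNormedType.Exports.
Import ComplexField.Normc.

Local Open Scope classical_set_scope.
Local Open Scope ring_scope.

Section metric_notions.
Context {R : realType}.

Definition distance_preserving (X Y : metricType R) (f : X -> Y) : Prop :=
  forall x y, mdist (f x) (f y) = mdist x y.

(* A map g : [0, a] -> X is given by a map on all of R, of which only the
   restriction to [0, a] matters. *)
Definition geodesic_map (X : metricType R) (x0 x1 : X) (g : R -> X) : Prop :=
  [/\ {in `[0, mdist x0 x1] &, forall s t : R, mdist (g s) (g t) = `|s - t|},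
      g 0 = x0 & g (mdist x0 x1) = x1].

Definition geodesic_segment (X : metricType R) (x0 x1 : X) (A : set X) : Prop :=
  exists2 g : R -> X, geodesic_map x0 x1 g & A = g @` `[0, mdist x0 x1].

Definition geodesic_space (X : metricType R) : Prop :=
  forall x0 x1 : X, exists A, geodesic_segment x0 x1 A.

Definition real_tree (X : metricType R) : Prop :=
  (forall x y : X, x != y -> exists! A, geodesic_segment x y A) /\
  (forall (a b c : X) (A B : set X),
     geodesic_segment a b A -> geodesic_segment b c B -> A `&` B = [set b] ->
     exists x y, geodesic_segment x y (A `|` B)).

(* The two points of V may coincide, so that a one-point tree qualifies. *)
Definition countably_many_vertices (T : metricType R) : Prop :=
  exists2 V : set T, countable V &
    forall p : T, exists v w A,
      [/\ V v, V w, geodesic_segment v w A & A p].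

Definition thick (X : metricType R) : Prop :=
  forall T : metricType R, real_tree T -> countably_many_vertices T ->
    exists f : T -> X, distance_preserving f.

Definition homogeneous (X : metricType R) : Prop :=
  forall x y : X, exists f : X -> X,
    [/\ bijective f, distance_preserving f & f x = y].

Definition diameter (X : metricType R) : \bar R :=
  ereal_sup [set (mdist p.1 p.2)%:E | p in [set: X * X]].

(* The subset A of T, with the induced metric, embeds at infinity into X;
   the values of x outside A are irrelevant. *)
Definition embeds_at_infinity (T : metricType R) (A : set T)
    (X : metricType R) : Prop :=
  exists eps : R^nat,
    [/\ forall i, 0 < eps i,
        eps i @[i --> \oo] --> (0 : R) &
        exists x : T -> nat -> X, forall t1 t2, A t1 -> A t2 ->
          eps i * mdist (x t1 i) (x t2 i) @[i --> \oo] --> mdist t1 t2].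

Definition asymptotic_subcone (X0 X : metricType R) : Prop :=
  [/\ diameter X = +oo%E, geodesic_space X0 &
      forall A : set X0, finite_set A -> embeds_at_infinity A X].

End metric_notions.

(* A continuous function on [0, pf_end] is represented by its extension by 0
   to R, so that Leibniz equality is equality of functions on [0, pf_end]. *)
Record path_fun (R : realType) := PathFun {
  pf_end : R ;
  pf_val :> R -> R ;
  pf_end_ge0 : 0 <= pf_end ;
  pf_continuous : {within `[0, pf_end], continuous pf_val} ;
  pf_val0 : pf_val 0 = 0 ;
  pf_out : forall t : R, t \notin `[0, pf_end] -> pf_val t = 0
}.

Section path_fun_metric.
Context {R : realType}.
Implicit Types f g h : path_fun R.

Definition agreement_times f g : set R :=
  [set t | t \in `[0, Num.min (pf_end f) (pf_end g)] /\
           forall t' : R, t' \in `[0, t[ -> f t' = g t'].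

Definition segregation f g : R := sup (agreement_times f g).

Definition path_dist f g : R :=
  (pf_end f - segregation f g) + (pf_end g - segregation f g).

Let agreement_times0 f g : agreement_times f g 0.
Proof.
split; first by rewrite in_itv /= lexx le_min !pf_end_ge0.
by move=> t; rewrite in_itv /= => /andP[t0 /(le_lt_trans t0)]; rewrite ltxx.
Qed.

Let agreement_times_ub f g : ubound (agreement_times f g) (Num.min (pf_end f) (pf_end g)).
Proof. by move=> t [+ _]; rewrite in_itv /= => /andP[]. Qed.

Let agreement_times_sup f g : has_sup (agreement_times f g).
Proof.
split; first by exists 0; exact: agreement_times0.
by exists (Num.min (pf_end f) (pf_end g)); exact: agreement_times_ub.
Qed.

Lemma segregation_ge0 f g : 0 <= segregation f g.
Proof. by apply: ub_le_sup (agreement_times0 f g); case: (agreement_times_sup f g). Qed.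

Lemma segregation_le_min f g :
  segregation f g <= Num.min (pf_end f) (pf_end g).
Proof. by apply: ge_sup (@agreement_times_ub f g); exists 0; exact: agreement_times0. Qed.

Lemma segregation_eq f g t : 0 <= t < segregation f g -> f t = g t.
Proof.
move=> /andP[t0 ts].
have [s [_ Es] tls] := sup_gt (ex_intro _ _ (agreement_times0 f g)) ts.
by apply: Es; rewrite in_itv /= t0.
Qed.

Lemma segregation_ge f g s : 0 <= s <= Num.min (pf_end f) (pf_end g) ->
  (forall t : R, 0 <= t < s -> f t = g t) -> s <= segregation f g.
Proof.
move=> sle Es; apply: ub_le_sup; first by case: (agreement_times_sup f g).
by split=> [|t]; rewrite in_itv //= => ?; exact: Es.
Qed.

Lemma segregationC f g : segregation f g = segregation g f.
Proof.
rewrite /segregation /agreement_times minC; congr sup; apply/seteqP.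
by split=> t [? E]; split=> // t' /E.
Qed.

Lemma segregationxx f : segregation f f = pf_end f.
Proof.
apply/eqP; rewrite eq_le; apply/andP; split.
  by have := segregation_le_min f f; rewrite minxx.
by apply: segregation_ge => //; rewrite minxx lexx pf_end_ge0.
Qed.

Lemma segregation_triangle g f h :
  Num.min (segregation f g) (segregation g h) <= segregation f h.
Proof.
have := segregation_le_min f g; have := segregation_le_min g h.
rewrite !le_min => /andP[gg gh] /andP[ff fg].
apply: segregation_ge => [|t /andP[t0]].
  rewrite !le_min !segregation_ge0 /=; apply/andP.
  by split; rewrite ge_min ?ff ?gh ?orbT.
by rewrite lt_min => /andP[t1 t2]; rewrite (@segregation_eq f g) ?t0 //
  (@segregation_eq g h) ?t0.
Qed.

Lemma path_fun_eq f g : pf_end f = pf_end g ->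
  (forall t : R, 0 <= t < pf_end f -> f t = g t) -> f = g.
Proof.
move=> Er Efg.
have Ev : pf_val f = pf_val g.
  apply/funext => t; have [tin|tout] := boolP (t \in `[0, pf_end f]); last first.
    by rewrite !pf_out -?Er.
  move: tin; rewrite in_itv /= => /andP[t0]; rewrite le_eqVlt => /predU1P[Et|tr]; last first.
    by apply: Efg; rewrite t0.
  move: t0; rewrite le_eqVlt => /predU1P[<-|t0]; first by rewrite !pf_val0.
  rewrite {}Et in t0 *.
  have [_ _ cf] := (continuous_within_itvP f t0).1 (@pf_continuous _ f).
  have t0' := t0; rewrite Er in t0'.
  have [_ _ cg] := (continuous_within_itvP g t0').1 (@pf_continuous _ g).
  rewrite -Er in cg.
  apply: (cvg_unique _ cf); first exact: norm_hausdorff.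
  apply: cvg_trans cg; apply: near_eq_cvg; near=> u.
  apply/esym/Efg/andP; split; near: u.
    exact: nbhs_left_ge.
  exact: nbhs_left_lt.
case: f g Er Ev {Efg} => [r f p1 p2 p3 p4] [r' f' q1 q2 q3 q4] /= Er Ev.
case: _ / Er in q1 q2 q4 *; case: _ / Ev in q2 q3 q4 *.
by congr PathFun; exact: Prop_irrelevance.
Unshelve. all: by end_near. Qed.

Lemma path_distxx f : path_dist f f = 0.
Proof. by rewrite /path_dist segregationxx subrr addr0. Qed.

Lemma path_distC f g : path_dist f g = path_dist g f.
Proof. by rewrite /path_dist segregationC addrC. Qed.

Lemma path_dist_eq0 f g : path_dist f g = 0 -> f = g.
Proof.
have := segregation_le_min f g; rewrite le_min /path_dist => /andP[sf sg] d0.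
have Ef : pf_end f = segregation f g by lra.
apply: path_fun_eq; first by lra.
by move=> t; rewrite Ef; exact: segregation_eq.
Qed.

Lemma path_dist_triangle g f h : path_dist f h <= path_dist f g + path_dist g h.
Proof.
have := segregation_le_min f g; have := segregation_le_min g h.
have := segregation_triangle g f h.
rewrite le_min le_min ge_min /path_dist => /orP tri /andP[gg gh] /andP[ff fg].
by case: tri => tri; lra.
Qed.

End path_fun_metric.

HB.instance Definition _ (R : realType) := gen_eqMixin (path_fun R).
HB.instance Definition _ (R : realType) := gen_choiceMixin (path_fun R).
HB.instance Definition _ (R : realType) := isMetric.Build R (path_fun R)
  path_distxx path_dist_eq0 path_distC path_dist_triangle.

Record hyp_plane (R : realType) := HypPlane {
  hp_val :> R[i] ;
  hp_lt1 : normc hp_val < 1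
}.

HB.instance Definition _ (R : realType) := [isSub for @hp_val R].
HB.instance Definition _ (R : realType) := [Choice of hyp_plane R by <:].

Section hyp_plane_metric.
Context {R : realType}.
Implicit Types x y z : hyp_plane R.

Definition hyp_dist x y : R :=
  let a := normc (1 - (x : R[i]) * (y : R[i])^*%C) in
  let b := normc ((x : R[i]) - (y : R[i])) in
  ln ((a + b) / (a - b)).

Let a x y : R := normc (1 - (x : R[i]) * (y : R[i])^*%C).
Let b x y : R := normc ((x : R[i]) - (y : R[i])).
Let w x : R := 1 - normc x ^+ 2.

Let normc_ge0 (u : R[i]) : 0 <= normc u.
Proof. by case: u => u1 u2; exact: sqrtr_ge0. Qed.

Let normc_conj (u : R[i]) : normc (u^*)%C = normc u.
Proof. by case: u => u1 u2; rewrite /normc /= sqrrN. Qed.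

Let w_gt0 x : 0 < w x.
Proof.
rewrite subr_gt0 -[ltRHS](expr1n _ 2).
by rewrite ltr_pXn2r ?nnegrE ?normc_ge0 // hp_lt1.
Qed.

Let a2Bb2 x y : a x y ^+ 2 - b x y ^+ 2 = w x * w y.
Proof.
rewrite /a /b /w; case: x y => [[x1 x2] ?] [[y1 y2] ?] /=.
by rewrite !sqr_sqrtr ?addr_ge0 ?sqr_ge0 //; ring.
Qed.

Let b_ge0 x y : 0 <= b x y. Proof. exact: normc_ge0. Qed.

Let bLa x y : b x y < a x y.
Proof.
rewrite -(@ltr_pXn2r _ 2) ?nnegrE ?normc_ge0 //.
by rewrite -subr_gt0 a2Bb2 mulr_gt0.
Qed.

Let bC x y : b x y = b y x.
Proof. by rewrite /b -[LHS]normcN opprB. Qed.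

Let conj1M (u v : R[i]) : ((1 - u * v^*) ^* = 1 - v * u^*)%C.
Proof.
by case: u v => [u1 u2] [v1 v2]; apply/eqP; rewrite eq_complex /=;
  apply/andP; split; apply/eqP; ring.
Qed.

Let aC x y : a x y = a y x.
Proof. by rewrite /a -[LHS]normc_conj conj1M. Qed.

Let hyp_dist_frac x y : (a x y + b x y) / (a x y - b x y) =
  (a x y + b x y) ^+ 2 / (w x * w y).
Proof.
have ab := bLa x y; have bp := b_ge0 x y.
rewrite -a2Bb2 subr_sqr expr2 mulrC -mulf_div divff ?mulr1 //; last by lra.
by rewrite mulrC.
Qed.

Let sub_triangle x y z : w y * (a x z + b x z) <=
  (a x y + b x y) * (a y z + b y z).
Proof.
have wn : w y = normc (Complex (w y) 0).
  by rewrite /normc expr0n addr0 sqrtr_sqr gtr0_norm.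
have Ew : Complex (w y) 0 = 1 - (y : R[i]) * (y : R[i])^*%C.
  rewrite /w; case: y {wn} => [[y1 y2] ?] /=.
  rewrite sqr_sqrtr ?addr_ge0 ?sqr_ge0 //; apply/eqP; rewrite eq_complex /=.
  by apply/andP; split; apply/eqP; ring.
have H1 : w y * a x z <= a x y * a y z + b x y * b y z.
  rewrite wn /a /b -normcM.
  rewrite -[X in _ <= _ + _ * X]normc_conj -!normcM.
  apply: le_trans (le_normcD _ _).
  rewrite Ew rmorphB /=.
  by rewrite le_eqVlt; apply/orP; left; apply/eqP; congr normc; ring.
have H2 : w y * b x z <= a x y * b y z + b x y * a y z.
  rewrite (aC y z) wn /a /b -!normcM.
  apply: le_trans (le_normcD _ _).
  rewrite Ew.
  by rewrite le_eqVlt; apply/orP; left; apply/eqP; congr normc; ring.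
by lra.
Qed.

Lemma hyp_distxx x : hyp_dist x x = 0.
Proof.
have := bLa x x; have := b_ge0 x x; rewrite /hyp_dist -/(a x x) -/(b x x).
have -> : b x x = 0 by rewrite /b subrr normc0.
by move=> _ a0; rewrite addr0 subr0 divff ?ln1 // gt_eqF.
Qed.

Lemma hyp_distC x y : hyp_dist x y = hyp_dist y x.
Proof. by rewrite /hyp_dist -!/(a _ _) -!/(b _ _) aC bC. Qed.

Lemma hyp_dist_eq0 x y : hyp_dist x y = 0 -> x = y.
Proof.
rewrite /hyp_dist -/(a x y) -/(b x y) => /eqP.
have ab := bLa x y; have bp := b_ge0 x y.
have p1 : 0 < a x y + b x y by lra.
have p2 : 0 < a x y - b x y by lra.
rewrite ln_eq0 ?divr_gt0 // => /eqP E.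
have {}E : a x y + b x y = a x y - b x y.
  by rewrite -[LHS](divfK (lt0r_neq0 p2)) E mul1r.
have b0 : b x y = 0 by lra.
by apply/val_inj/eqP; rewrite -subr_eq0; apply/eqP; exact: eq0_normc b0.
Qed.

Lemma hyp_dist_triangle y x z : hyp_dist x z <= hyp_dist x y + hyp_dist y z.
Proof.
rewrite /hyp_dist -!/(a _ _) -!/(b _ _) !hyp_dist_frac.
have p u v : 0 < a u v + b u v by rewrite ltr_wpDr ?(le_lt_trans _ (bLa u v)).
have ww u v : 0 < w u * w v by rewrite mulr_gt0.
have q u v : 0 < (a u v + b u v) ^+ 2 / (w u * w v).
  by rewrite divr_gt0 // exprn_gt0.
rewrite -lnM ?posrE // ler_ln ?posrE //; last by rewrite mulr_gt0.
have -> : (a x z + b x z) ^+ 2 / (w x * w z) =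
    (w y * (a x z + b x z)) ^+ 2 / (w x * w y * (w y * w z)).
  by field; rewrite !gt_eqF.
rewrite mulf_div -exprMn; apply: ler_wpM2r.
  by rewrite invr_ge0 ltW // mulr_gt0.
by rewrite ler_sqr ?sub_triangle // nnegrE ltW // mulr_gt0.
Qed.

End hyp_plane_metric.

HB.instance Definition _ (R : realType) := isMetric.Build R (hyp_plane R)
  hyp_distxx hyp_dist_eq0 hyp_distC hyp_dist_triangle.

(* Main.v *)
(* A geodesic space whose Gromov products satisfy the ultrametric inequality
   is a real tree, and conversely. In the space of paths, based at the path of
   length 0, the Gromov product is the moment of segregation.

   Thickness: a tree with vertices v_0, v_1, ... is the increasing union of
   the subtrees T_n spanned by a base point o and v_0, ..., v_n; the point x
   is sent to the piecewise linear path of length d(o, x) whose slope at time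
   t is the least n such that the geodesic from o to x has not left T_n before
   t. Where two such geodesics separate, the slopes become different.

   Homogeneity: subtracting f carries f to a zero path of length rho. An
   involution that reverses the segment of zero paths of length at most rho,
   and moves the branches leaving it accordingly, carries this path to the
   root. Only at the two ends of the segment does this need care: the germs
   available at its top are all germs, those at the root all but the zero germ.

   Subcone: in the right half-plane model, the points
   exp(-n |f|) + i theta_n(f) and exp(-n |g|) + i theta_n(g), where |f| is the
   length of f, have distance about n d(f, g), provided that
   theta_n(f) - theta_n(g) is of the order of exp(-n s) when f and g segregate
   at a time s before both ends, and at most of that order otherwise. *)

Require Import Defs.
From mathcomp Require Import all_boot all_order all_algebra.
From mathcomp Require Import all_classical all_reals all_analysis.
From mathcomp Require Import complex.
From mathcomp Require Import ring lra.

Set Implicit Arguments.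
Unset Strict Implicit.
Unset Printing Implicit Defensive.

Import Order.TTheory GRing.Theory Num.Theory.
Import numFieldNormedType.Exports.
Import ComplexField.Normc.

Local Open Scope classical_set_scope.
Local Open Scope ring_scope.

(** * Real trees and Gromov products *)

Section trees.
Context {R : realType}.
Implicit Type X : metricType R.

Definition gromov X (o x y : X) : R :=
  (mdist o x + mdist o y - mdist x y) / 2.

Definition zero_hyperbolic X : Prop := forall o x y z : X,
  Num.min (gromov o x y) (gromov o y z) <= gromov o x z.

Lemma gromovC X (o x y : X) : gromov o x y = gromov o y x.
Proof. by rewrite /gromov (metric_sym x y) [mdist o x + _]addrC. Qed.

Lemma gromov_ge0 X (o x y : X) : 0 <= gromov o x y.
Proof.
have := metric_triangle x o y; rewrite (metric_sym x o) /gromov; lra.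
Qed.

Lemma gromov_lel X (o x y : X) : gromov o x y <= mdist o x.
Proof. have := metric_triangle o x y; rewrite /gromov; lra. Qed.

Lemma gromov_ler X (o x y : X) : gromov o x y <= mdist o y.
Proof. by rewrite gromovC gromov_lel. Qed.

Lemma zero_hyperbolicP X (o x y z : X) (t : R) : zero_hyperbolic X ->
  t <= gromov o x y -> t <= gromov o y z -> t <= gromov o x z.
Proof. by move=> H h1 h2; apply: le_trans (H o x y z); rewrite le_min h1. Qed.

Section geodesic_map.
Variables (X : metricType R) (x0 x1 : X) (g : R -> X).
Hypothesis gg : geodesic_map x0 x1 g.

Lemma geodesic_dist s t : 0 <= s <= mdist x0 x1 -> 0 <= t <= mdist x0 x1 ->
  mdist (g s) (g t) = `|s - t|.
Proof. by case: gg => H _ _ ? ?; apply: H; rewrite in_itv. Qed.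

Lemma geodesic_dist_le s t : 0 <= s -> s <= t -> t <= mdist x0 x1 ->
  mdist (g s) (g t) = t - s.
Proof. by move=> s0 st tD; rewrite geodesic_dist 1?distrC ?ger0_norm; lra. Qed.

Lemma geodesic_distl t : 0 <= t <= mdist x0 x1 -> mdist x0 (g t) = t.
Proof.
move=> /[dup] tD /andP[t0 _]; case: gg => _ <- _.
by rewrite geodesic_dist ?lexx ?mdist_ge0 // sub0r normrN ger0_norm.
Qed.

Lemma geodesic_distr t : 0 <= t <= mdist x0 x1 ->
  mdist (g t) x1 = mdist x0 x1 - t.
Proof.
move=> /[dup] tD /andP[_ t1]; case: gg => _ _ E.
rewrite -{1}E geodesic_dist ?lexx ?mdist_ge0 // distrC ger0_norm //.
by rewrite subr_ge0.
Qed.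

Lemma geodesic_rev :
  geodesic_map x1 x0 (fun t => g (mdist x0 x1 - t)).
Proof.
rewrite /geodesic_map (metric_sym x1 x0); split => [s t||]; last 2 first.
- by rewrite subr0; case: gg.
- by rewrite subrr; case: gg.
rewrite !in_itv /= => sD tD; rewrite geodesic_dist; [|lra|lra].
by rewrite -[in RHS]normrN; congr `|_|; ring.
Qed.

End geodesic_map.

Lemma geodesic_mapP X (x0 x1 : X) (g : R -> X) (D : R) : D = mdist x0 x1 ->
  g 0 = x0 -> g D = x1 ->
  (forall s t, 0 <= s -> s <= t -> t <= D -> mdist (g s) (g t) = t - s) ->
  geodesic_map x0 x1 g.
Proof.
rewrite /geodesic_map => <- g0 gD H; split => // s t; rewrite !in_itv /=.
move=> /andP[s0 sD] /andP[t0 tD]; have [st|ts] := leP s t.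
  by rewrite H // distrC ger0_norm // subr_ge0.
by rewrite metric_sym H ?(ltW ts) // gtr0_norm // subr_gt0.
Qed.

Lemma geodesic_segmentC X (x y : X) A :
  geodesic_segment x y A -> geodesic_segment y x A.
Proof.
move=> [g gg ->]; exists (fun t => g (mdist x y - t)).
  exact: geodesic_rev.
rewrite (metric_sym y x); apply/seteqP; split => _ [t tD <-].
  exists (mdist x y - t); last by congr g; lra.
  by move: tD; rewrite /= !in_itv /=; lra.
exists (mdist x y - t) => //.
by move: tD; rewrite /= !in_itv /=; lra.
Qed.

Lemma geodesic_cat X (a b c : X) (g h : R -> X) :
  geodesic_map a b g -> geodesic_map b c h ->
  mdist a c = mdist a b + mdist b c ->
  geodesic_segment a c
    (g @` `[0, mdist a b] `|` h @` `[0, mdist b c]).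
Proof.
move=> gg hh E; have d1 := mdist_ge0 a b; have d2 := mdist_ge0 b c.
pose f t := if t <= mdist a b then g t else h (t - mdist a b).
exists f; last first.
  apply/seteqP; split => [_ [[t tD <-]|[t tD <-]]|_ [t tD <-]].
  - move: tD; rewrite /= in_itv /= => tD.
    by exists t; [rewrite /= in_itv /=; lra|rewrite /f ifT //; lra].
  - move: tD; rewrite /= in_itv /= => tD.
    exists (mdist a b + t); first by rewrite /= in_itv /=; lra.
    rewrite /f; case: leP => [t0|_]; last by congr h; lra.
    have -> : t = 0 by lra.
    by rewrite addr0; case: gg => _ _ ->; case: hh.
  move: tD; rewrite /= in_itv /= => tD; rewrite /f; case: leP => ct.
    by left; exists t => //=; rewrite in_itv /=; lra.
  by right; exists (t - mdist a b) => //=; rewrite in_itv /=; lra.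
apply: (@geodesic_mapP _ _ _ _ (mdist a b + mdist b c)) => //.
- by rewrite /f d1; case: gg.
- rewrite /f; case: leP => [h0|_]; last first.
    by rewrite addrAC subrr add0r; case: hh.
  have bc0 : mdist b c = 0 by lra.
  by rewrite bc0 addr0 -(mdist_positivity _ _ bc0); case: gg.
move=> s t s0 st tD; rewrite /f; case: (leP t) => ct.
  rewrite ifT; last lra.
  by rewrite (geodesic_dist_le gg); lra.
case: leP => cs; last first.
  by rewrite (geodesic_dist_le hh); lra.
(* For times on both sides of the joint, the detour through [b] bounds the distance from above, and
   additivity of [mdist a c] bounds it from below. *)
have := metric_triangle (g s) b (h (t - mdist a b)).
have := metric_triangle a (g s) c.
have := metric_triangle (g s) (h (t - mdist a b)) c.
rewrite (geodesic_distl gg) ?(geodesic_distr gg) ?(geodesic_distl hh)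
  ?(geodesic_distr hh); lra.
Qed.

(** Seen from [x], the Gromov product of [g t] and [y] and that of [y] and [h t] are both [t]. Hence
    that of [g t] and [h t] is at least [t], which forces their distance to be 0. *)
Lemma zero_hyperbolic_segment_unique X (x y : X) A B : zero_hyperbolic X ->
  geodesic_segment x y A -> geodesic_segment x y B -> A = B.
Proof.
move=> H [g gg ->] [h hh ->].
suff E : forall t, t \in `[0, mdist x y] -> g t = h t.
  by apply/seteqP; split=> _ [t tD <-]; exists t; rewrite ?E.
move=> t; rewrite in_itv /= => tD; apply: mdist_positivity.
have h1 : t <= gromov x (g t) y.
  by rewrite /gromov (geodesic_distl gg) // (geodesic_distr gg) //; lra.
have h2 : t <= gromov x y (h t).
  rewrite gromovC.
  by rewrite /gromov (geodesic_distl hh) // (geodesic_distr hh) //; lra.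
have := zero_hyperbolicP H h1 h2.
have := mdist_ge0 (g t) (h t).
rewrite /gromov (geodesic_distl gg) // (geodesic_distl hh) //; lra.
Qed.

(** For the union axiom, take the points [p] and [q] of the two segments at distance
    [s = gromov b a c] from [b]. The ultrametric inequality makes them equal, so they lie in the
    intersection and are [b]. Then [s = 0], which is additivity of the distance through [b]. *)
Lemma zero_hyperbolic_real_tree X :
  zero_hyperbolic X -> geodesic_space X -> real_tree X.
Proof.
move=> H G; split=> [x y _|a b c A B [g gg ->] [h hh ->] I].
  have [A SA] := G x y; exists A; split => // B.
  exact: zero_hyperbolic_segment_unique.
exists a, c; apply: geodesic_cat => //.
pose s := gromov b a c.
have s0 : 0 <= s := gromov_ge0 _ _ _.
have sa : s <= mdist a b by rewrite (metric_sym a) gromov_lel.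
have sc : s <= mdist b c := gromov_ler _ _ _.
pose p := g (mdist a b - s); pose q := h s.
have bp : mdist b p = s.
  by rewrite metric_sym (geodesic_distr gg) /= ?in_itv /=; lra.
have bq : mdist b q = s by rewrite (geodesic_distl hh) /= ?in_itv /=; lra.
have h1 : s <= gromov b p a.
  rewrite /gromov bp (metric_sym p) (geodesic_distl gg); last lra.
  by rewrite (metric_sym b); lra.
have h2 : s <= gromov b c q.
  by rewrite gromovC /gromov bq (geodesic_distr hh); lra.
have := zero_hyperbolicP H (zero_hyperbolicP H h1 (lexx _)) h2.
rewrite /gromov bp bq => h3; have := mdist_ge0 p q => h4.
have pq : p = q by apply: mdist_positivity; lra.
have : [set b] p.
  rewrite -I; split; first by exists (mdist a b - s) => //=; rewrite in_itv /=; lra.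
  by rewrite pq; exists s => //=; rewrite in_itv /=; lra.
move=> /= pb; move: bp; rewrite pb mdistxx /s /gromov (metric_sym b a); lra.
Qed.

End trees.

(** * From the tree axioms to the ultrametric inequality *)

Section real_trees.
Context {R : realType}.
Implicit Type X : metricType R.

Lemma geodesic_sub X (x y : X) g s t : geodesic_map x y g ->
  0 <= s -> s <= t -> t <= mdist x y ->
  geodesic_map (g s) (g t) (fun u => g (s + u)).
Proof.
move=> gg s0 st tD.
apply: (@geodesic_mapP _ _ _ _ _ (t - s)); last 1 first.
- move=> u v u0 uv vD.
  by rewrite (geodesic_dist_le gg); lra.
- by rewrite (geodesic_dist_le gg); lra.
- by rewrite addr0.
- by rewrite addrC subrK.
Qed.

Lemma geodesic_between X (x y : X) k s t : geodesic_map x y k ->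
  0 <= s <= mdist x y -> 0 <= t <= mdist x y ->
  exists2 A, geodesic_segment (k s) (k t) A &
    forall u, Num.min s t <= u <= Num.max s t -> A (k u).
Proof.
move=> kk; wlog st : s t / s <= t => [W sD tD|sD tD].
  case/orP: (le_total s t) => [st|ts]; first exact: W.
  have [A SA HA] := W t s ts tD sD; exists A; first exact: geodesic_segmentC.
  by rewrite minC maxC.
have k' : geodesic_map (k s) (k t) (fun u => k (s + u)).
  by apply: (geodesic_sub kk); lra.
exists ((fun u => k (s + u)) @` `[0, mdist (k s) (k t)]).
  by exists (fun u => k (s + u)).
move=> u; rewrite min_l // max_r // => usD; exists (u - s); last by congr k; lra.
by rewrite /= in_itv /= (geodesic_dist_le kk); lra.
Qed.

Lemma geodesic_segmentl X (x y : X) A : geodesic_segment x y A -> A x.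
Proof.
move=> [g [_ g0 _] ->]; exists 0 => //=.
by rewrite in_itv /= lexx mdist_ge0.
Qed.

Lemma geodesic_segmentr X (x y : X) A : geodesic_segment x y A -> A y.
Proof. by move/geodesic_segmentC/geodesic_segmentl. Qed.

Lemma real_tree_segment_unique X (x y : X) A B : real_tree X -> x != y ->
  geodesic_segment x y A -> geodesic_segment x y B -> A = B.
Proof.
move=> [H _] xy SA SB; have [C [SC HC]] := H _ _ xy.
by rewrite -(HC _ SA) -(HC _ SB).
Qed.

(** The union axiom yields a geodesic [k] without naming its endpoints. So [a], [b], [c] are located
    at times [s], [t], [u] of [k]. By uniqueness [A] and [B] are the parts of [k] between these
    times, and they meet in [b] alone only if [t] lies between [s] and [u]. *)
Lemma real_tree_dist_cat X (a b c : X) A B : real_tree X ->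
  geodesic_segment a b A -> geodesic_segment b c B -> A `&` B = [set b] ->
  mdist a c = mdist a b + mdist b c.
Proof.
move=> TX SA SB I.
have [->|ab] := eqVneq a b; first by rewrite mdistxx add0r.
have [<-|bc] := eqVneq b c; first by rewrite mdistxx addr0.
have [x [y [k kk E]]] := TX.2 _ _ _ _ _ SA SB I.
have E' z : (A `|` B) z -> exists2 s, 0 <= s <= mdist x y & k s = z.
  by rewrite E => -[s + <-]; rewrite /= in_itv /=; exists s.
have [|s sD ka] := E' a; first by left; apply: geodesic_segmentl SA.
have [|t tD kb] := E' b; first by left; apply: geodesic_segmentr SA.
have [|u uD kc] := E' c; first by right; apply: geodesic_segmentr SB.
have [A' SA' HA] := geodesic_between kk sD tD.
have [B' SB' HB] := geodesic_between kk tD uD.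
rewrite ka kb in SA'; rewrite kb kc in SB'.
rewrite -(real_tree_segment_unique TX ab SA SA') in HA.
rewrite -(real_tree_segment_unique TX bc SB SB') in HB.
have st : s != t by apply: contra_neq ab => e; rewrite -ka -kb e.
have tu : t != u by apply: contra_neq bc => e; rewrite -kc -kb e.
have K v : Num.min s t <= v <= Num.max s t ->
    Num.min t u <= v <= Num.max t u -> v = t.
  move=> v1 v2.
  have : [set b] (k v) by rewrite -I; split; [exact: HA|exact: HB].
  have vD : 0 <= v <= mdist x y.
    move: v1; rewrite ge_min le_max => /andP[/orP[] + /orP[]]; lra.
  rewrite -kb => /= e; have := geodesic_dist kk vD tD.
  by rewrite e mdistxx => /esym/eqP; rewrite normr_eq0 subr_eq0 => /eqP.
rewrite -ka -kb -kc !(geodesic_dist kk) //.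
(* If [t] lay below both [s] and [u], the smaller of these would be a second common time; if above
   both, the larger would. *)
have {K} [K1 K2] : (t < s -> t < u -> False) /\ (s < t -> u < t -> False).
  split=> h1 h2.
    have := K (Num.min s u).
    rewrite (@min_r _ _ s t) ?(@max_l _ _ s t) ?(@min_l _ _ t u)
      ?(@max_r _ _ t u) ?(ltW h1) ?(ltW h2) //.
    rewrite !le_min !ge_min !lexx !(ltW h1) !(ltW h2) orbT /= => /(_ isT isT) e.
    by have := lt_min t s u; rewrite e ltxx h1 h2.
  have := K (Num.max s u).
  rewrite (@min_l _ _ s t) ?(@max_r _ _ s t) ?(@min_r _ _ t u)
    ?(@max_l _ _ t u) ?(ltW h1) ?(ltW h2) //.
  rewrite !ge_max !le_max !lexx !(ltW h1) !(ltW h2) orbT /= => /(_ isT isT) e.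
  by have := gt_max t s u; rewrite e ltxx h1 h2.
case: (ltgtP s t) => h1; last by rewrite h1 eqxx in st.
  have h2 : t < u by rewrite lt_neqAle tu leNgt; apply/negP; exact: K2.
  by rewrite !ltr0_norm; lra.
have h2 : u < t by rewrite lt_neqAle eq_sym tu leNgt; apply/negP; exact: K1.
by rewrite !gtr0_norm; lra.
Qed.

Lemma real_tree_geodesic X (x y : X) : real_tree X ->
  exists g, geodesic_map x y g.
Proof.
move=> [H _]; have [<-|xy] := eqVneq x y; last first.
  by have [A [[g gg _] _]] := H _ _ xy; exists g.
exists (fun=> x); apply: (@geodesic_mapP _ _ _ _ _ 0) => //.
  by rewrite mdistxx.
by move=> s t s0 st t0; rewrite mdistxx; lra.
Qed.

(** Uniqueness of segments concerns sets; it passes to the maps because the parameter of a point is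
    its distance from [x]. *)
Lemma real_tree_map_unique X (x y : X) g h t : real_tree X ->
  geodesic_map x y g -> geodesic_map x y h -> 0 <= t <= mdist x y -> g t = h t.
Proof.
move=> TX gg hh tD.
have [xy|xy] := eqVneq x y.
  move: tD; rewrite xy mdistxx -eq_le => /eqP <-.
  by case: gg => _ -> _; case: hh.
have SG : geodesic_segment x y (g @` `[0, mdist x y]) by exists g.
have SH : geodesic_segment x y (h @` `[0, mdist x y]) by exists h.
have : (h @` `[0, mdist x y]) (g t).
  rewrite -(real_tree_segment_unique TX xy SG SH).
  by exists t => //=; rewrite in_itv.
move=> [u]; rewrite /= in_itv /= => uD e.
have := geodesic_distl gg tD; rewrite -e (geodesic_distl hh uD) => <-.
by [].
Qed.

(* The two geodesics agree up to the time [s] at which they separate, and the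
   second tree axiom, applied at the separation point, shows that [s] is the
   Gromov product. *)
Lemma real_tree_agree X (o x y : X) g h t : real_tree X ->
  geodesic_map o x g -> geodesic_map o y h -> 0 <= t <= gromov o x y ->
  g t = h t.
Proof.
move=> TX gg hh tD.
pose E := [set u | [/\ 0 <= u, u <= mdist o x, u <= mdist o y & g u = h u]].
have E0 : E 0.
  by split; rewrite ?lexx ?mdist_ge0 //; case: gg => _ -> _; case: hh.
have bE : has_ubound E by exists (mdist o x) => u [].
have sE : has_sup E by split; first exists 0.
pose s := sup E.
have s0 : 0 <= s by apply: ub_le_sup.
have sx : s <= mdist o x by apply: ge_sup; [exists 0|move=> u []].
have sy : s <= mdist o y by apply: ge_sup; [exists 0|move=> u []].
(* The supremum is attained: were [g s] and [h s] at a distance [d > 0], an agreement time within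
   [d / 2] of [s] would put both at less than [d / 2] from a common point. *)
have gh : g s = h s.
  apply: mdist_positivity; apply/eqP; rewrite eq_le mdist_ge0 andbT leNgt.
  apply/negP => d0; have : s - mdist (g s) (h s) / 2 < sup E by rewrite -/s; lra.
  move=> /(sup_gt (ex_intro _ _ E0)) [u [u0 ux uy guh] su].
  have us : u <= s by apply: ub_le_sup.
  have := metric_triangle (g s) (g u) (h s).
  rewrite {2}guh (geodesic_dist gg) ?(geodesic_dist hh); try lra.
  by rewrite ger0_norm ?ler0_norm; lra.
have g2 : geodesic_map (g s) x (fun u => g (s + u)).
  case: (gg) => _ _ <-; exact: (geodesic_sub gg).
have h2 : geodesic_map (g s) y (fun u => h (s + u)).
  rewrite gh; case: (hh) => _ _ <-; exact: (geodesic_sub hh).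
have dx : mdist (g s) x = mdist o x - s by rewrite (geodesic_distr gg); lra.
have dy : mdist (g s) y = mdist o y - s by rewrite gh (geodesic_distr hh); lra.
have dxy : mdist x y = mdist x (g s) + mdist (g s) y.
  apply: (@real_tree_dist_cat _ _ _ _
    ((fun u => g (s + u)) @` `[0, mdist (g s) x])
    ((fun u => h (s + u)) @` `[0, mdist (g s) y])) => //.
  - by apply: geodesic_segmentC; exists (fun u => g (s + u)).
  - by exists (fun u => h (s + u)).
  apply/seteqP; split => [_ [[u + <-] [v]]|_ ->]; last first.
    split; exists 0; rewrite /= ?in_itv /= ?lexx ?mdist_ge0 ?addr0 //.
  rewrite /= !in_itv /= dx dy => uD vD e.
  have uv : s + u = s + v.
    rewrite -(@geodesic_distl _ _ _ _ _ gg (s + u)); last lra.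
    by rewrite -e (geodesic_distl hh); lra.
  have Esu : E (s + u) by split; [lra|lra|lra|rewrite -e uv].
  have us : s + u <= s by apply: ub_le_sup.
  by congr g; lra.
have sg : gromov o x y = s.
  by rewrite /gromov dxy (metric_sym x) dx dy; lra.
have go : geodesic_map o (g s) g.
  have := @geodesic_sub _ _ _ _ 0 s gg (lexx _) s0 sx.
  by case: (gg) => _ -> _; under eq_fun do rewrite add0r.
have ho : geodesic_map o (g s) h.
  have := @geodesic_sub _ _ _ _ 0 s hh (lexx _) s0 sy.
  by rewrite -gh; case: (hh) => _ -> _; under eq_fun do rewrite add0r.
apply: (real_tree_map_unique TX go ho).
by rewrite (geodesic_distl gg); lra.
Qed.

(** The geodesics from [o] to [x], [y] and [z] all pass through one point at time [t]. Going from
    [x] to [z] through it bounds [mdist x z]. *)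
Lemma real_tree_zero_hyperbolic X : real_tree X -> zero_hyperbolic X.
Proof.
move=> TX o x y z.
set t := Num.min _ _.
have t0 : 0 <= t by rewrite le_min !gromov_ge0.
have : t <= t by []; rewrite {2}/t le_min => /andP[t1 t2].
have [g gg] := real_tree_geodesic o x TX.
have [h hh] := real_tree_geodesic o y TX.
have [k kk] := real_tree_geodesic o z TX.
have e : g t = k t.
  rewrite (real_tree_agree TX gg hh) ?t0 //.
  by rewrite (real_tree_agree TX hh kk) ?t0.
have tx : t <= mdist o x := le_trans t1 (gromov_lel _ _ _).
have tz : t <= mdist o z := le_trans t2 (gromov_ler _ _ _).
have := metric_triangle x (g t) z.
rewrite {2}e (metric_sym x (g t)) (geodesic_distr gg) ?(geodesic_distr kk); try lra.
by rewrite /gromov; lra.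
Qed.

End real_trees.

(** * The tree of paths *)

Section paths.
Context {R : realType}.
Implicit Types (f g h : path_fun R) (s t u e : R) (F G : R -> R).

Lemma segregation_lel f g : segregation f g <= pf_end f.
Proof. by have := segregation_le_min f g; rewrite le_min => /andP[]. Qed.

Lemma segregation_ler f g : segregation f g <= pf_end g.
Proof. by have := segregation_le_min f g; rewrite le_min => /andP[]. Qed.

Lemma le_segregation f g s : 0 <= s -> s <= pf_end f -> s <= pf_end g ->
  (forall t, 0 <= t < s -> f t = g t) -> s <= segregation f g.
Proof. by move=> s0 sf sg; apply: segregation_ge; rewrite le_min s0 sf. Qed.

Lemma mdist_pathE f g :
  mdist f g = pf_end f + pf_end g - 2 * segregation f g.
Proof. by rewrite /mdist /= /path_dist; lra. Qed.

Lemma path_trivial f g : pf_end f = 0 -> pf_end g = 0 -> f = g.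
Proof.
move=> f0 g0; apply: path_fun_eq => [|t]; first by rewrite f0.
by rewrite f0 => /andP[t0 /(le_lt_trans t0)]; rewrite ltxx.
Qed.

(** The stored extension by 0 may jump at [pf_end f]; this one, constant outside the domain, is
    continuous on the whole line. *)
Definition pf_ext f t : R := f (Num.max 0 (Num.min t (pf_end f))).

Lemma pf_ext_in f t : 0 <= t <= pf_end f -> pf_ext f t = f t.
Proof. by move=> /andP[t0 te]; rewrite /pf_ext min_l // max_r. Qed.

Lemma pf_ext_le0 f t : t <= 0 -> pf_ext f t = 0.
Proof.
by move=> t0; rewrite /pf_ext max_l ?pf_val0 // ge_min t0.
Qed.

Lemma pf_ext_continuous f : continuous (pf_ext f).
Proof.
move=> x; pose cl t : R := Num.max 0 (Num.min t (pf_end f)).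
have clA t : `[0, pf_end f]%classic (cl t).
  by rewrite /= in_itv /= /cl le_max lexx ge_max pf_end_ge0 ge_min lexx orbT.
have ccl : {for x, continuous cl}.
  apply: (@continuous_max R R (fun=> 0) (fun t => Num.min t (pf_end f))).
    exact: cst_continuous.
  apply: (@continuous_min R R id (fun=> pf_end f)).
    exact: cvg_id.
  exact: cst_continuous.
have /subspace_continuousP cf := @pf_continuous R f.
apply: cvg_comp (cf (cl x) (clA x)).
move=> P; rewrite /within /= => nP.
have /= := ccl _ nP; rewrite nbhs_simpl /=.
by apply: filterS => t; apply; exact: clA.
Qed.

Lemma root_continuous : {within `[0 : R, 0], continuous (fun=> 0 : R)}.
Proof. by apply: continuous_subspaceT => x; exact: cst_continuous. Qed.

Definition root_path : path_fun R :=
  @PathFun R 0 (fun=> 0) (lexx 0) root_continuous erefl (fun _ _ => erefl).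

(** The choice by [xget] keeps proofs of continuity out of the term; [root_path] is the value when
    no such path exists. *)
Definition path_of e F : path_fun R :=
  xget root_path
    [set h | pf_end h = e /\ forall t, 0 <= t <= e -> h t = F t].

Section path_of.
Variables (e : R) (F : R -> R).
Hypotheses (e0 : 0 <= e) (cF : continuous F) (F0 : F 0 = 0).

Lemma path_of_ex :
  exists h, pf_end h = e /\ forall t, 0 <= t <= e -> h t = F t.
Proof.
pose H t := if t \in `[0, e] then F t else 0.
have cH : {within `[0, e], continuous H}.
  have : {within `[0, e], continuous F} by exact: continuous_subspaceT.
  apply: subspace_eq_continuous => t /set_mem /= tD.
  by rewrite /H /from_subspace tD.
have H0 : H 0 = 0 by rewrite /H F0 if_same.
have Hout t : t \notin `[0, e] -> H t = 0 by rewrite /H => /negbTE ->.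
exists (PathFun e0 cH H0 Hout); split=> //= t tD.
by rewrite /H in_itv /= tD.
Qed.

Lemma path_ofP : pf_end (path_of e F) = e /\
  forall t, 0 <= t <= e -> path_of e F t = F t.
Proof. exact: (xgetPex root_path path_of_ex). Qed.

Lemma path_of_end : pf_end (path_of e F) = e.
Proof. by case: path_ofP. Qed.

Lemma path_of_val t : 0 <= t <= e -> path_of e F t = F t.
Proof. by case: path_ofP => _; apply. Qed.

End path_of.

Definition restr f e : path_fun R := path_of e (pf_ext f).

Lemma restr_end f e : 0 <= e -> pf_end (restr f e) = e.
Proof.
by move=> e0; apply: path_of_end => //; [exact: pf_ext_continuous|exact: pf_ext_le0].
Qed.

Lemma restr_val f e t : 0 <= t <= e -> e <= pf_end f -> restr f e t = f t.
Proof.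
move=> /andP[t0 te] ef; rewrite path_of_val ?t0 //.
- by rewrite pf_ext_in // t0 (le_trans te).
- exact: le_trans te.
- exact: pf_ext_continuous.
- exact: pf_ext_le0.
Qed.

(** Continuity extends the agreement to the moment of segregation itself; it enters through
    [path_fun_eq], applied to the restrictions to that time. *)
Lemma segregation_eq_le f g t : 0 <= t <= segregation f g -> f t = g t.
Proof.
move=> tD; set s := segregation f g in tD.
have s0 : 0 <= s := segregation_ge0 f g.
have sf : s <= pf_end f := segregation_lel f g.
have sg : s <= pf_end g := segregation_ler f g.
rewrite -(restr_val tD sf) -(restr_val tD sg); congr (pf_val _ t).
apply: path_fun_eq; rewrite !restr_end // => u /andP[u0 us].
by rewrite !restr_val ?u0 ?(ltW us) // (@segregation_eq _ f g) ?u0.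
Qed.

Lemma segregation_restr f s t : 0 <= s -> s <= t -> t <= pf_end f ->
  segregation (restr f s) (restr f t) = s.
Proof.
move=> s0 st tf; have t0 := le_trans s0 st; have sf := le_trans st tf.
apply/eqP; rewrite eq_le; apply/andP; split.
  by rewrite -[leRHS](restr_end f s0) segregation_lel.
apply: le_segregation; rewrite ?restr_end // => u /andP[u0 us].
by rewrite !restr_val ?u0 ?(ltW us) // ltW // (lt_le_trans us).
Qed.

Lemma restr_full f : restr f (pf_end f) = f.
Proof.
apply: path_fun_eq; rewrite restr_end ?pf_end_ge0 // => t /andP[t0 tf].
by rewrite restr_val ?t0 ?(ltW tf).
Qed.

Lemma mdist_restr f s t : 0 <= s -> s <= t -> t <= pf_end f ->
  mdist (restr f s) (restr f t) = t - s.
Proof.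
move=> s0 st tf; rewrite mdist_pathE segregation_restr // !restr_end //; first lra.
exact: le_trans st.
Qed.

Lemma restr_geodesic_map f s : 0 <= s <= pf_end f ->
  geodesic_map (restr f s) f (fun u => restr f (s + u)).
Proof.
move=> /andP[s0 sf]; apply: (@geodesic_mapP _ _ _ _ _ (pf_end f - s)).
- by rewrite -{3}(restr_full f) mdist_restr.
- by rewrite addr0.
- by rewrite addrC subrK restr_full.
- by move=> u v *; rewrite mdist_restr; lra.
Qed.

Lemma path_geodesic_space : geodesic_space (path_fun R).
Proof.
move=> f g; set s := segregation f g.
have s0 : 0 <= s := segregation_ge0 f g.
have sf : s <= pf_end f := segregation_lel f g.
have sg : s <= pf_end g := segregation_ler f g.
have e : restr f s = restr g s.
  apply: path_fun_eq; rewrite !restr_end // => t /andP[t0 ts].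
  by rewrite !restr_val ?t0 ?(ltW ts) // (@segregation_eq _ f g) ?t0.
have gf : geodesic_map (restr f s) f (fun u => restr f (s + u)).
  by apply: restr_geodesic_map; rewrite s0.
have gg : geodesic_map (restr f s) g (fun u => restr g (s + u)).
  by rewrite e; apply: restr_geodesic_map; rewrite s0.
have df : mdist f (restr f s) = pf_end f - s.
  by rewrite metric_sym -{2}(restr_full f) mdist_restr.
have dg : mdist (restr f s) g = pf_end g - s.
  by rewrite e -{2}(restr_full g) mdist_restr.
have d : mdist f g = mdist f (restr f s) + mdist (restr f s) g.
  by rewrite df dg mdist_pathE -/s; lra.
by eexists; apply: (geodesic_cat (geodesic_rev gf) gg d).
Qed.

(** The lengths cancel. In the moments of segregation the claim is the four-point condition that
    [xz + oy] is at least the smaller of [xy + oz] and [yz + ox], which follows from the ultrametric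
    inequalities within triples. *)
Lemma path_zero_hyperbolic : zero_hyperbolic (path_fun R).
Proof.
move=> o x y z; rewrite /gromov !mdist_pathE ge_min.
have := segregation_triangle y x z; have := segregation_triangle x o y.
have := segregation_triangle z o y; have := segregation_triangle o x z.
have := segregation_triangle x y z; have := segregation_triangle z x y.
rewrite !ge_min (segregationC x o) (segregationC y x) (segregationC z y).
move: (segregation o x) (segregation o y) (segregation o z)
  (segregation x y) (segregation y z) (segregation x z).
move=> ox oy oz xy yz xz t1 t2 t3 t4 t5 t6.
rewrite -[_ || _]negbK negb_or -!ltNge; apply/negP => /andP[h1 h2].
case/orP: t1 => ?; case/orP: t2 => ?; try lra;
case/orP: t3 => ?; try lra; case/orP: t4 => ?; try lra;
case/orP: t5 => ?; try lra; case/orP: t6 => ?; lra.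
Qed.

Lemma path_real_tree : real_tree (path_fun R).
Proof.
exact: zero_hyperbolic_real_tree path_zero_hyperbolic path_geodesic_space.
Qed.

End paths.

(** * Thickness *)

Section tree_embedding.
Context {R : realType} (T : metricType R) (o : T) (v : nat -> T) (N : T -> nat).
Hypothesis hypT : zero_hyperbolic T.
(** The equality says that [x] lies between [o] and [v (N x)], hence in the subtree of stage
    [N x]. *)
Hypothesis vN : forall x, gromov o x (v (N x)) = mdist o x.
Implicit Types (x y w : T) (n : nat) (t : R).

(* [reach x n] is the distance from [o] to the projection of [x] to the
   subtree spanned by [o], [v 0], ..., [v n]. *)
Fixpoint reach x n : R :=
  if n is n'.+1 then Num.max (reach x n') (gromov o x (v n))
  else gromov o x (v 0%N).

Lemma reach_homo x : {homo reach x : m n / (m <= n)%N >-> m <= n}.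
Proof.
apply: homo_leq => [a|b a c|n] //; first exact: le_trans.
by rewrite /= le_max lexx.
Qed.

Lemma reach_ge x n : gromov o x (v n) <= reach x n.
Proof. by case: n => [|n] //=; rewrite le_max lexx orbT. Qed.

(* The number of indices [n] with [reach x n < t] is the slope at [t]: a
   branch created at stage [n] is sent to a segment of slope [n]. *)
Definition profile x t : R :=
  \sum_(0 <= n < N x) Num.max 0 (t - reach x n).

(** From stage [N x] on, [reach x n] is at least [mdist o x], so further terms vanish. Two profiles
    can thus be compared with equally many terms. *)
Lemma profile_widen x M t : (N x <= M)%N -> t <= mdist o x ->
  profile x t = \sum_(0 <= n < M) Num.max 0 (t - reach x n).
Proof.
move=> NM tx; rewrite (big_cat_nat _ NM) //= [X in _ + X]big_nat_cond.
rewrite [X in _ + X]big1 ?addr0 // => n /andP[/andP[Nn _] _].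
rewrite max_l // subr_le0 (le_trans tx) // -(vN x).
exact: le_trans (reach_ge _ _) (reach_homo _ Nn).
Qed.

Lemma profile0 x : profile x 0 = 0.
Proof.
rewrite /profile big1_seq // => n _; rewrite max_l // sub0r oppr_le0.
by apply: le_trans (gromov_ge0 o x (v 0%N)) (reach_homo x (leq0n n)).
Qed.

Lemma profile_continuous x : continuous (profile x).
Proof.
apply: continuous_big => [|n _ t]; first exact: add_continuous.
apply: (@continuous_max R R (fun=> 0) (fun t => t - reach x n)).
  exact: cst_continuous.
by apply: cvgB; [exact: cvg_id|exact: cvg_cst].
Qed.

Definition tree_path x : path_fun R := path_of (mdist o x) (profile x).

Lemma tree_path_end x : pf_end (tree_path x) = mdist o x.
Proof.
apply: path_of_end; [exact: mdist_ge0|exact: profile_continuous|exact: profile0].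
Qed.

Lemma tree_path_val x t : 0 <= t <= mdist o x -> tree_path x t = profile x t.
Proof.
apply: path_of_val; [exact: mdist_ge0|exact: profile_continuous|exact: profile0].
Qed.

(** Among the three Gromov products of [x], [y] and a vertex the smallest occurs at least twice:
    either [x] and [y] have equal products with the vertex, or their mutual product is at most both.
    Taking maxima keeps this alternative. *)
Lemma reach_alt x y n : reach x n = reach y n \/
  gromov o x y <= reach x n /\ gromov o x y <= reach y n.
Proof.
have H w : gromov o x w = gromov o y w \/
    gromov o x y <= gromov o x w /\ gromov o x y <= gromov o y w.
  have := @hypT o x y w; have := @hypT o y x w; have := @hypT o x w y.
  rewrite (gromovC o y x) (gromovC o w y) !ge_min.
  case: (ltgtP (gromov o x w) (gromov o y w)) => [||->]; last by left.
    by case: (leP (gromov o x y) (gromov o x w)); [lra|];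
       case: (leP (gromov o x y) (gromov o y w)); lra.
  by case: (leP (gromov o x y) (gromov o x w)); [|];
     case: (leP (gromov o x y) (gromov o y w)); lra.
elim: n => [|n IH] /=; first exact: H.
case: IH => [->|[h1 h2]].
  by case: (H (v n.+1)) => [->|[h1 h2]]; [left|right; rewrite !le_max h1 h2 !orbT].
by right; rewrite !le_max h1 h2.
Qed.

(** Let [a] be the first stage at which [x] or [y] reaches beyond [p]. Earlier terms of the two
    profiles are equal. At stage [a] only one of the points reaches beyond [p], so just after time
    [p] the profile of the other is strictly larger. *)
Lemma segregation_tree_path_le x y :
  segregation (tree_path x) (tree_path y) <= gromov o x y.
Proof.
rewrite leNgt; apply/negP; set p := gromov o x y; set s := segregation _ _ => ps.
have sx : s <= mdist o x by rewrite -tree_path_end segregation_lel.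
have sy : s <= mdist o y by rewrite -tree_path_end segregation_ler.
have p0 : 0 <= p := gromov_ge0 _ _ _.
pose P n := (p < reach x n) || (p < reach y n).
have exP : exists n, P n.
  exists (N x); apply/orP; left; apply: lt_le_trans (reach_ge _ _).
  by rewrite vN; lra.
case: (ex_minnP exP) => a Pa mina.
have {mina} below n : (n < a)%N -> reach x n <= p /\ reach y n <= p.
  move=> na; have : ~~ P n by apply/negP => /mina; rewrite leqNgt na.
  by rewrite negb_or -!leNgt => /andP.
(* No point shares with both [x] and [y] more than these share with each other. *)
have vle w : gromov o x w <= p \/ gromov o y w <= p.
  have := @hypT o x w y; rewrite ge_min -/p (gromovC o w y).
  by case/orP; [left|right].
have one : reach x a <= p \/ reach y a <= p.
  case: a Pa below => [|a] _ below; first exact: vle.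
  have [//|bx By] := below a; rewrite /= !ge_max bx By /=.
  exact: vle.
have eqb n : (n < a)%N -> reach x n = reach y n.
  move=> /below [h1 h2]; case: (reach_alt x y n) => [//|]; rewrite -/p => -[h3 h4].
  by apply/eqP; rewrite eq_le (le_trans h1 h4) (le_trans h2 h3).
pose t := (p + Num.min s (Num.max (reach x a) (reach y a))) / 2.
have tp : p < t < Num.min s (Num.max (reach x a) (reach y a)).
  have : p < Num.min s (Num.max (reach x a) (reach y a)).
    by rewrite lt_min ps lt_max.
  by rewrite /t; lra.
case/andP: tp => pt; rewrite lt_min => /andP[ts tr].
have t0 : 0 <= t by lra.
have : tree_path x t = tree_path y t by apply: segregation_eq; rewrite t0.
pose M := maxn a.+1 (maxn (N x) (N y)).
have aM : (a < M)%N by rewrite leq_max leqnn.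
rewrite !tree_path_val ?t0 ?(@profile_widen _ M); try lra; last 2 first.
  by rewrite !leq_max leqnn !orbT.
  by rewrite !leq_max leqnn !orbT.
rewrite !(big_cat_nat (leq0n a) (ltnW aM)) /= !(big_ltn aM).
under eq_big_nat => n na do rewrite eqb //.
move/addrI.
have main z z' : reach z a <= p -> t < reach z' a ->
  Num.max 0 (t - reach z a) + \sum_(a.+1 <= i < M) Num.max 0 (t - reach z i) =
  Num.max 0 (t - reach z' a) + \sum_(a.+1 <= i < M) Num.max 0 (t - reach z' i)
  -> False.
  move=> za za'; rewrite [X in _ = X + _]max_l ?subr_le0 ?(ltW za') // add0r.
  rewrite [X in _ = X]big_nat_cond [X in _ = X]big1; last first.
    move=> n /andP[/andP[an _] _]; rewrite max_l // subr_le0 (le_trans (ltW za')) //.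
    exact: reach_homo (ltnW an).
  rewrite max_r; last lra.
  have : 0 <= \sum_(a.+1 <= i < M) Num.max 0 (t - reach z i).
    by apply: sumr_ge0 => i _; rewrite le_max lexx.
  lra.
move: tr; rewrite lt_max; case: one => one /orP[] tr.
- lra.
- exact: main one tr.
- by move/esym; exact: main one tr.
- lra.
Qed.

Lemma segregation_tree_path x y :
  segregation (tree_path x) (tree_path y) = gromov o x y.
Proof.
apply/eqP; rewrite eq_le segregation_tree_path_le /=.
apply: le_segregation; rewrite ?tree_path_end ?gromov_ge0 ?gromov_lel ?gromov_ler //.
move=> t /andP[t0 tp].
have tx : t <= mdist o x := le_trans (ltW tp) (gromov_lel _ _ _).
have ty : t <= mdist o y := le_trans (ltW tp) (gromov_ler _ _ _).
rewrite !tree_path_val ?t0 //.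
rewrite !(@profile_widen _ (maxn (N x) (N y))) ?leq_maxl ?leq_maxr //.
(* Where the reaches may differ, both are at least the Gromov product, so both terms vanish. *)
apply: eq_bigr => n _; case: (reach_alt x y n) => [->//|[h1 h2]].
by rewrite !max_l // subr_le0 (le_trans (ltW tp)).
Qed.

Lemma tree_path_distance_preserving : distance_preserving tree_path.
Proof.
move=> x y; rewrite mdist_pathE segregation_tree_path !tree_path_end /gromov.
lra.
Qed.

End tree_embedding.

Lemma path_thick (R : realType) : thick (path_fun R).
Proof.
move=> T TT [V cV HV].
have [[r Vr]|V0] := pselect (exists r, V r); last first.
  (* Every point lies on a segment between vertices, so without vertices the tree is empty. *)
  exists (fun=> root_path) => x; have [w [w' [A [Vw _ _ _]]]] := HV x.
  by case: V0; exists w.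
have hypT := real_tree_zero_hyperbolic TT.
have /countable_injP[i inji] := cV.
pose v n := xget r [set w | V w /\ i w = n].
have vi w : V w -> v (i w) = w.
  move=> Vw.
  have /(xgetPex r) : exists w', [set w' | V w' /\ i w' = i w] w' by exists w.
  by case=> Vw' /inji; apply; rewrite inE.
have exN x : exists n, gromov r x (v n) = mdist r x.
  have [a [b [A [Va Vb [g gg ->] [t]]]]] := HV x.
  rewrite /= in_itv /= => tD gt.
  have da := geodesic_distl gg tD; have db := geodesic_distr gg tD.
  rewrite gt in da db.
  (* Based at [x], the Gromov product of [a] and [b] is 0, so that of [r] with one of them is 0 as
     well: [x] lies between [r] and this vertex. *)
  have := hypT x a r b; rewrite ge_min /gromov.
  rewrite (metric_sym x a) da db (metric_sym x r) => H.
  have ta := metric_triangle r x a; have tb := metric_triangle r x b.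
  rewrite (metric_sym x a) da db in ta tb.
  case/orP: H => H.
    exists (i a); rewrite vi // /gromov.
    have := metric_triangle r a x.
    rewrite (metric_sym x a) da (metric_sym a r) in H *; lra.
  exists (i b); rewrite vi // /gromov.
  have := metric_triangle r b x.
  by rewrite (metric_sym b x) db; lra.
have [N HN] := choice exN.
by exists (tree_path r v N); exact: tree_path_distance_preserving.
Qed.

(** * Homogeneity *)

Section path_operations.
Context {R : realType}.
Implicit Types (f h k : path_fun R) (c t u : R) (F : R -> R) (n : nat).

Definition delay c k : path_fun R :=
  path_of (c + pf_end k) (fun x => pf_ext k (x - c)).

Definition tail t h : path_fun R :=
  path_of (pf_end h - t) (fun x => pf_ext h (x + t)).

Definition add_path F k : path_fun R :=
  path_of (pf_end k) (fun x => pf_ext k x + F x).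

Definition zero_path c : path_fun R := path_of c (fun=> 0).

Lemma pf_ext_shift_continuous k c : continuous (fun x => pf_ext k (x + c)).
Proof.
move=> x; apply: (@continuous_comp R R R (fun x => x + c)); last first.
  exact: pf_ext_continuous.
by apply: cvgD; [exact: cvg_id|exact: cvg_cst].
Qed.

Lemma zero_path_end c : 0 <= c -> pf_end (zero_path c) = c.
Proof. by move=> c0; apply: path_of_end => // x; exact: cst_continuous. Qed.

Lemma zero_path_val c t : 0 <= t <= c -> zero_path c t = 0.
Proof.
move=> /andP[t0 tc]; rewrite path_of_val ?t0 //; last exact: cst_continuous.
exact: le_trans tc.
Qed.

Section delay.
Variables (c : R) (k : path_fun R).
Hypothesis c0 : 0 <= c.

Let delayP : pf_end (delay c k) = c + pf_end k /\
  forall t, 0 <= t <= c + pf_end k -> delay c k t = pf_ext k (t - c).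
Proof.
apply: path_ofP; first by rewrite addr_ge0 ?pf_end_ge0.
- exact: pf_ext_shift_continuous.
- by rewrite pf_ext_le0 // sub0r oppr_le0.
Qed.

Lemma delay_end : pf_end (delay c k) = c + pf_end k.
Proof. by case: delayP. Qed.

Lemma delay_before t : 0 <= t <= c -> delay c k t = 0.
Proof.
have := pf_end_ge0 k => k0 /andP[t0 tc]; rewrite (proj2 delayP); last lra.
by rewrite pf_ext_le0 // subr_le0.
Qed.

Lemma delay_after u : 0 <= u <= pf_end k -> delay c k (c + u) = k u.
Proof.
move: c0 => c0' uD; rewrite (proj2 delayP); last lra.
by rewrite addrAC subrr add0r pf_ext_in.
Qed.

End delay.

Section tail.
Variables (t : R) (h : path_fun R).
Hypotheses (tD : 0 <= t <= pf_end h) (ht : h t = 0).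

Let tailP : pf_end (tail t h) = pf_end h - t /\
  forall u, 0 <= u <= pf_end h - t -> tail t h u = pf_ext h (u + t).
Proof.
apply: path_ofP; first by rewrite subr_ge0; case/andP: tD.
- exact: pf_ext_shift_continuous.
- by rewrite add0r pf_ext_in.
Qed.

Lemma tail_end : pf_end (tail t h) = pf_end h - t.
Proof. by case: tailP. Qed.

Lemma tail_val u : 0 <= u <= pf_end h - t -> tail t h u = h (t + u).
Proof.
by move: tD => tD' uD; rewrite (proj2 tailP) // addrC pf_ext_in //; lra.
Qed.

End tail.

Section add_path.
Variable F : R -> R.
Hypotheses (cF : continuous F) (F0 : F 0 = 0).

Let add_pathP k : pf_end (add_path F k) = pf_end k /\
  forall t, 0 <= t <= pf_end k -> add_path F k t = pf_ext k t + F t.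
Proof.
apply: path_ofP; first exact: pf_end_ge0.
- by move=> x; apply: cvgD; [exact: pf_ext_continuous|exact: cF].
- by rewrite pf_ext_le0 // F0 addr0.
Qed.

Lemma add_path_end k : pf_end (add_path F k) = pf_end k.
Proof. by case: (add_pathP k). Qed.

Lemma add_path_val k t : 0 <= t <= pf_end k -> add_path F k t = k t + F t.
Proof. by move=> tD; rewrite (proj2 (add_pathP k)) // pf_ext_in. Qed.

Lemma segregation_add_path k1 k2 :
  segregation k1 k2 <= segregation (add_path F k1) (add_path F k2).
Proof.
have s1 := segregation_lel k1 k2; have s2 := segregation_ler k1 k2.
apply: le_segregation; rewrite ?add_path_end ?segregation_ge0 //.
move=> t /andP[t0 ts]; rewrite !add_path_val; try lra.
by rewrite (@segregation_eq _ k1 k2) ?t0.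
Qed.

End add_path.

Lemma add_pathK F G : continuous F -> F 0 = 0 -> continuous G ->
  (forall x, G x = - F x) -> cancel (add_path F) (add_path G).
Proof.
move=> cF F0 cG GF k.
have G0 : G 0 = 0 by rewrite GF F0 oppr0.
apply: path_fun_eq; rewrite !add_path_end // => t /andP[t0 tk].
by rewrite !add_path_val ?add_path_end ?t0 ?(ltW tk) // GF addrK.
Qed.

Lemma tail_delay c k : 0 <= c -> tail c (delay c k) = k.
Proof.
move=> c0; have k0 := pf_end_ge0 k.
have cD : 0 <= c <= pf_end (delay c k) by rewrite delay_end; lra.
have dc : delay c k c = 0 by rewrite delay_before // c0 lexx.
apply: path_fun_eq; rewrite tail_end // delay_end //; first lra.
move=> t tD; rewrite tail_val ?delay_end; try lra.
by rewrite delay_after //; lra.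
Qed.

Lemma delay_tail t h : 0 <= t <= pf_end h ->
  (forall u, 0 <= u <= t -> h u = 0) -> delay t (tail t h) = h.
Proof.
move=> /[dup] tD /andP[t0 th] h0; have ht : h t = 0 by rewrite h0 // t0 lexx.
apply: path_fun_eq; rewrite delay_end // tail_end //; first lra.
move=> u /andP[u0 uh]; case: (leP u t) => ut.
  by rewrite delay_before ?u0 // h0 ?u0.
have -> : u = t + (u - t) by lra.
by rewrite delay_after ?tail_end ?tail_val //; lra.
Qed.

Lemma segregation_delay c k1 k2 : 0 <= c ->
  c + segregation k1 k2 <= segregation (delay c k1) (delay c k2).
Proof.
move=> c0; have s1 := segregation_lel k1 k2; have s2 := segregation_ler k1 k2.
have s0 := segregation_ge0 k1 k2.
apply: le_segregation; rewrite ?delay_end ?lerD2l ?addr_ge0 //.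
move=> t /andP[t0 ts]; case: (leP t c) => tc.
  by rewrite !delay_before ?t0.
have -> : t = c + (t - c) by lra.
by rewrite !delay_after ?(@segregation_eq _ k1 k2); lra.
Qed.

Lemma segregation_tail t h1 h2 : 0 <= t -> h1 t = 0 -> h2 t = 0 ->
  t <= segregation h1 h2 ->
  segregation h1 h2 - t <= segregation (tail t h1) (tail t h2).
Proof.
move=> t0 e1 e2 ts; have s1 := segregation_lel h1 h2; have s2 := segregation_ler h1 h2.
have d1 : 0 <= t <= pf_end h1 by lra.
have d2 : 0 <= t <= pf_end h2 by lra.
apply: le_segregation; rewrite ?tail_end; try lra.
move=> u uD; rewrite !tail_val; try lra.
by apply: segregation_eq; lra.
Qed.

(* Hilbert's hotel on the germs at 0: [germ_up] sends the germ of [u |-> n u] to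
   that of [u |-> n.+1 u] and fixes all others, so that it is a bijection
   from all germs to the nonzero ones. *)
Definition germ n k : Prop :=
  exists2 d, 0 < d & forall u, 0 <= u < d -> u <= pf_end k -> k u = n%:R * u.

Definition germ_up k : path_fun R :=
  if `[< exists n, germ n k >] then add_path id k else k.

Definition germ_down k : path_fun R :=
  if `[< exists n, germ n.+1 k >] then add_path (fun x => - x) k else k.

Let id_continuous : continuous (id : R -> R).
Proof. by move=> x; exact: cvg_id. Qed.

Let opp_continuous : continuous (fun x : R => - x).
Proof. by move=> x; apply: cvgN; exact: cvg_id. Qed.

Lemma germ_up_end k : pf_end (germ_up k) = pf_end k.
Proof. by rewrite /germ_up; case: asboolP => // _; rewrite add_path_end. Qed.

Lemma germ_down_end k : pf_end (germ_down k) = pf_end k.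
Proof.
by rewrite /germ_down; case: asboolP => // _; rewrite add_path_end ?oppr0.
Qed.

Lemma germ_add n k : germ n k -> germ n.+1 (add_path id k).
Proof.
move=> [d d0 H]; exists d => // u /andP[u0 ud]; rewrite add_path_end // => uk.
by rewrite add_path_val ?u0 ?uk // H ?u0 ?ud // -natr1 mulrDl mul1r.
Qed.

Lemma germ_sub n k : germ n.+1 k -> germ n (add_path (fun x => - x) k).
Proof.
move=> [d d0 H]; exists d => // u /andP[u0 ud]; rewrite add_path_end ?oppr0 // => uk.
by rewrite add_path_val ?oppr0 ?u0 ?uk // H ?u0 ?ud // -natr1 mulrDl mul1r addrK.
Qed.

(** A path of length 0 has every germ, whence the positive length; the slope is read off at a small
    positive time. *)
Lemma germ_inj n m k : 0 < pf_end k -> germ n k -> germ m k -> n = m.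
Proof.
move=> k0 [d d0 H] [d' d'0 H'].
pose u := Num.min (pf_end k) (Num.min d d') / 2.
have u0 : 0 < Num.min (pf_end k) (Num.min d d') by rewrite !lt_min k0 d0.
have [uk [ud ud']] : u < pf_end k /\ u < d /\ u < d'.
  have : u < Num.min (pf_end k) (Num.min d d') by rewrite /u; lra.
  by rewrite !lt_min => /and3P[].
have up : 0 < u by rewrite /u; lra.
have : n%:R * u = m%:R * u.
  by rewrite -(H u) ?(H' u) ?(ltW up) ?(ltW uk) ?ud ?ud'.
move/(mulIf (lt0r_neq0 up))/eqP; by rewrite eqr_nat => /eqP.
Qed.

(** Paths that agree for a positive time are thus treated alike by [germ_up] and [germ_down]. *)
Lemma germ_segregation n k1 k2 :
  0 < segregation k1 k2 -> germ n k1 -> germ n k2.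
Proof.
move=> s0 [d d0 H]; exists (Num.min d (segregation k1 k2)).
  by rewrite lt_min d0.
move=> u /andP[u0]; rewrite lt_min => /andP[ud us] _.
have s1 := segregation_lel k1 k2.
rewrite -(@segregation_eq _ k1 k2) ?u0 // H ?u0 //.
exact: le_trans (ltW us) s1.
Qed.

Lemma germ_upK : cancel germ_up germ_down.
Proof.
move=> k; rewrite /germ_up; case: asboolP => [[n gk]|ng].
  rewrite /germ_down asboolT; last by exists n; exact: germ_add.
  exact: add_pathK.
by rewrite /germ_down asboolF // => -[n gk]; apply: ng; exists n.+1.
Qed.

(** The zero germ must be excluded: [germ_down] fixes it, and [germ_up] would then move it to slope
    1. *)
Lemma germ_downK k : (0 < pf_end k -> ~ germ 0 k) -> germ_up (germ_down k) = k.
Proof.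
have := pf_end_ge0 k; rewrite le_eqVlt => /predU1P[k0 _|k0 /(_ k0) nk].
  by apply: path_trivial; rewrite ?germ_up_end ?germ_down_end -k0.
rewrite /germ_down; case: asboolP => [[n gk]|ng].
  rewrite /germ_up asboolT; last by exists n; exact: germ_sub.
  by apply: add_pathK => //= [|x]; rewrite ?oppr0 ?opprK.
by rewrite /germ_up asboolF // => -[[|n] gk]; [exact: nk|apply: ng; exists n].
Qed.

Lemma germ_up_nonzero k : 0 < pf_end k -> ~ germ 0 (germ_up k).
Proof.
move=> k0; rewrite /germ_up; case: asboolP => [[n /germ_add gk] g0|ng g0].
  by have := germ_inj _ g0 gk; rewrite add_path_end // => /(_ k0).
by apply: ng; exists 0%N.
Qed.

Lemma segregation_germ_up k1 k2 :
  segregation k1 k2 <= segregation (germ_up k1) (germ_up k2).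
Proof.
have := segregation_ge0 k1 k2; rewrite le_eqVlt => /predU1P[<-|s0].
  exact: segregation_ge0.
have s0' := s0; rewrite segregationC in s0'.
rewrite /germ_up; case: asboolP => [[n g1]|n1].
  rewrite asboolT; last by exists n; exact: germ_segregation g1.
  exact: segregation_add_path.
by rewrite asboolF // => -[n g2]; apply: n1; exists n; exact: germ_segregation g2.
Qed.

Lemma segregation_germ_down k1 k2 :
  segregation k1 k2 <= segregation (germ_down k1) (germ_down k2).
Proof.
have := segregation_ge0 k1 k2; rewrite le_eqVlt => /predU1P[<-|s0].
  exact: segregation_ge0.
have s0' := s0; rewrite segregationC in s0'.
rewrite /germ_down; case: asboolP => [[n g1]|n1].
  rewrite asboolT; last by exists n; exact: germ_segregation g1.
  by apply: segregation_add_path; rewrite ?oppr0.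
by rewrite asboolF // => -[n g2]; apply: n1; exists n; exact: germ_segregation g2.
Qed.

End path_operations.

(** * Reversal of a segment of zero paths *)

Section flip.
Context {R : realType} (rho : R) (rho0 : 0 < rho).
Implicit Types (h k : path_fun R) (c t u : R).

Let Z : path_fun R := zero_path rho.
(** Distance from the root to the projection of [h] to the segment joining the root to [Z]. *)
Let T h : R := segregation h Z.

Let rho_ge0 : 0 <= rho. Proof. exact: ltW. Qed.

Let Z_end : pf_end Z = rho. Proof. exact: zero_path_end. Qed.

Let T_ge0 h : 0 <= T h. Proof. exact: segregation_ge0. Qed.

Let T_le h : T h <= rho. Proof. by rewrite -Z_end segregation_ler. Qed.

Let T_le_end h : T h <= pf_end h. Proof. exact: segregation_lel. Qed.

Let T_bounds h : 0 <= T h <= pf_end h. Proof. by rewrite T_ge0 T_le_end. Qed.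

Let T_zero h t : 0 <= t <= T h -> h t = 0.
Proof.
move=> tD; rewrite (segregation_eq_le tD) zero_path_val //.
by case/andP: tD => -> /le_trans -> //; exact: T_le.
Qed.

Let T_root h : h (T h) = 0.
Proof. by rewrite T_zero // lexx T_ge0. Qed.

Definition turn t k : path_fun R :=
  if t == rho then germ_up k else if t == 0 then germ_down k else k.

(* The flip reverses the segment of zero paths of length at most [rho],
   carrying along the branches that leave it. A branch at an endpoint of the
   segment may have any germ at [rho], but only a nonzero one at 0, whence
   the shift of germs in [turn]. *)
Definition flip h : path_fun R :=
  delay (rho - T h) (turn (T h) (tail (T h) h)).

Lemma turn_end t k : pf_end (turn t k) = pf_end k.
Proof.
rewrite /turn; case: eqP => _; first exact: germ_up_end.
by case: eqP => _ //; exact: germ_down_end.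
Qed.

Lemma segregation_turn t k1 k2 :
  segregation k1 k2 <= segregation (turn t k1) (turn t k2).
Proof.
rewrite /turn; case: eqP => _; first exact: segregation_germ_up.
by case: eqP => _ //; exact: segregation_germ_down.
Qed.

(** A branch leaving before [rho] with zero germ would follow [Z] for a further time [d'], contrary
    to the choice of [T h]. *)
Lemma tail_nonzero h : T h < rho ->
  0 < pf_end (tail (T h) h) -> ~ germ 0 (tail (T h) h).
Proof.
move=> Tr; rewrite tail_end // => k0 [d d0 H].
pose d' := Num.min d (Num.min (rho - T h) (pf_end h - T h)).
have d'0 : 0 < d' by rewrite !lt_min d0 k0 subr_gt0 Tr.
have [d1 d2 d3] : [/\ d' <= d, d' <= rho - T h & d' <= pf_end h - T h].
  by rewrite /d' !ge_min !lexx !orbT.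
have T0 := T_ge0 h.
suff : T h + d' <= T h by lra.
apply: le_segregation; rewrite ?Z_end; try lra.
move=> t /andP[t0 tT]; rewrite zero_path_val; last by rewrite t0 /=; lra.
case: (leP t (T h)) => tT'; first by rewrite T_zero // t0.
have : tail (T h) h (t - T h) = 0.
  by rewrite H ?tail_end // ?mul0r //; lra.
by rewrite tail_val //; [rewrite addrC subrK|lra].
Qed.

Lemma turn_nonzero h : 0 < T h -> 0 < pf_end (tail (T h) h) ->
  ~ germ 0 (turn (T h) (tail (T h) h)).
Proof.
move=> T0 k0; rewrite /turn; case: eqP => [_|/eqP Tr].
  exact: germ_up_nonzero.
rewrite gt_eqF //; apply: tail_nonzero => //.
by rewrite lt_neqAle Tr T_le.
Qed.

Lemma segregation_delay_zero c k : 0 <= c <= rho ->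
  (c < rho -> 0 < pf_end k -> ~ germ 0 k) -> T (delay c k) = c.
Proof.
move=> /andP[c0 cr] H; have k0 := pf_end_ge0 k.
apply/eqP; rewrite eq_le; apply/andP; split; last first.
  apply: le_segregation; rewrite ?Z_end ?delay_end //; first lra.
  move=> t /andP[t0 tc]; rewrite delay_before ?t0 ?(ltW tc) //.
  by rewrite zero_path_val // t0 (le_trans (ltW tc)).
rewrite leNgt; apply/negP => cT.
have := T_le (delay c k); have := T_le_end (delay c k).
rewrite delay_end // => Tk Tr.
apply: H; [lra|lra|].
exists (T (delay c k) - c); first lra.
move=> u /andP[u0 uT] uk; rewrite mul0r -(@delay_after _ c) ?u0 //.
by rewrite T_zero //; lra.
Qed.

Lemma T_flip h : T (flip h) = rho - T h.
Proof.
have := T_ge0 h; have := T_le h => Tr T0.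
apply: segregation_delay_zero; first lra.
move=> Tp; rewrite turn_end; apply: turn_nonzero; lra.
Qed.

Lemma turnK t k : (t < rho -> 0 < pf_end k -> ~ germ 0 k) ->
  turn (rho - t) (turn t k) = k.
Proof.
move=> H; rewrite /turn (_ : (rho - t == rho) = (t == 0)); last first.
  by apply/eqP/eqP; lra.
rewrite subr_eq0 [rho == t]eq_sym.
case: (eqVneq t rho) => [->|tr].
  by rewrite gt_eqF // germ_upK.
case: eqP => t0 //; rewrite germ_downK //; apply: H.
by rewrite t0.
Qed.

Lemma flipK : involutive flip.
Proof.
move=> h; rewrite {1}/flip T_flip subKr.
have -> : tail (rho - T h) (flip h) = turn (T h) (tail (T h) h).
  by rewrite tail_delay // subr_ge0.
rewrite turnK; last exact: tail_nonzero.
by rewrite delay_tail // => u; exact: T_zero.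
Qed.

Lemma flip_end h : pf_end (flip h) = rho + pf_end h - 2 * T h.
Proof.
by rewrite delay_end ?subr_ge0 // turn_end tail_end //; lra.
Qed.

(** If both paths leave the segment at the same time, the flip shifts what follows equally for both.
    If [T h1 < T h2], they segregate no later than [T h1], and both flipped paths vanish until
    [rho - T h2]. *)
Lemma flip_segregation h1 h2 :
  rho - T h1 - T h2 + segregation h1 h2 <= segregation (flip h1) (flip h2).
Proof.
wlog : h1 h2 / T h1 <= T h2 => [W|].
  case/orP: (le_total (T h1) (T h2)); first exact: W.
  move/W; rewrite segregationC (segregationC (flip h2)); lra.
have a1 := T_le h1; have a2 := T_le h2.
have b1 := T_le_end h1; have b2 := T_le_end h2.
have c1 := T_ge0 h1; have c2 := T_ge0 h2.
rewrite le_eqVlt => /predU1P[e|lt12].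
  have Ts : T h1 <= segregation h1 h2.
    have := segregation_triangle Z h1 h2.
    by rewrite (segregationC Z h2) -/(T h1) -/(T h2) -e minxx.
  rewrite /flip -e; have e2 : h2 (T h1) = 0 by rewrite e T_root.
  have H1 := segregation_tail c1 (T_root h1) e2 Ts.
  have H2 := segregation_turn (T h1) (tail (T h1) h1) (tail (T h1) h2).
  have r0 : 0 <= rho - T h1 by rewrite subr_ge0.
  apply: le_trans (segregation_delay _ _ r0); lra.
have sT : segregation h1 h2 <= T h1.
  have := segregation_triangle h2 h1 Z; rewrite ge_min -/(T h2) -/(T h1).
  by case/orP => //; lra.
suff : rho - T h2 <= segregation (flip h1) (flip h2) by lra.
apply: le_segregation; rewrite ?flip_end; try lra.
move=> t /andP[t0 tT]; rewrite !delay_before //; rewrite ?subr_ge0 // t0 /=; lra.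
Qed.

Lemma flip_lipschitz h1 h2 : mdist (flip h1) (flip h2) <= mdist h1 h2.
Proof.
have := flip_segregation h1 h2; rewrite !mdist_pathE !flip_end; lra.
Qed.

Lemma flip_zero_path : flip Z = root_path.
Proof.
by apply: path_trivial => //; rewrite flip_end /T segregationxx Z_end; lra.
Qed.

End flip.

(** This is why one-sided estimates of the segregation suffice above: the maps come with inverses
    obeying the same bound. *)
Lemma lipschitz_cancel (R : realType) (X : metricType R) (f g : X -> X) :
  cancel f g -> (forall x y, mdist (f x) (f y) <= mdist x y) ->
  (forall x y, mdist (g x) (g y) <= mdist x y) -> distance_preserving f.
Proof.
move=> fK lf lg x y; apply/eqP; rewrite eq_le lf /=.
by rewrite -{1}(fK x) -{1}(fK y) lg.
Qed.

Section homogeneity.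
Context {R : realType}.
Implicit Types f h : path_fun R.

Lemma add_path_lipschitz (F : R -> R) h1 h2 : continuous F -> F 0 = 0 ->
  mdist (add_path F h1) (add_path F h2) <= mdist h1 h2.
Proof.
move=> cF F0; have := segregation_add_path cF F0 h1 h2.
rewrite !mdist_pathE !add_path_end //; lra.
Qed.

Lemma path_to_root f : exists phi : path_fun R -> path_fun R,
  [/\ bijective phi, distance_preserving phi & phi f = root_path].
Proof.
pose G t := - pf_ext f t.
have cF : continuous (pf_ext f) := @pf_ext_continuous R f.
have F0 : pf_ext f 0 = 0 by rewrite pf_ext_le0.
have cG : continuous G by move=> x; apply: cvgN; exact: cF.
have G0 : G 0 = 0 by rewrite /G F0 oppr0.
have K1 : cancel (add_path G) (add_path (pf_ext f)).
  by apply: add_pathK => // x; rewrite opprK.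
have K2 : cancel (add_path (pf_ext f)) (add_path G) by exact: add_pathK.
have bG : bijective (add_path G) by exists (add_path (pf_ext f)).
have dG : distance_preserving (add_path G).
  by apply: (lipschitz_cancel K1) => x y; exact: add_path_lipschitz.
have Ef : add_path G f = zero_path (pf_end f).
  have f0 := pf_end_ge0 f.
  apply: path_fun_eq; rewrite add_path_end ?zero_path_end // => t /andP[t0 tf].
  rewrite add_path_val ?t0 ?(ltW tf) // zero_path_val ?t0 ?(ltW tf) //.
  by rewrite /G pf_ext_in ?subrr // t0 ltW.
have := pf_end_ge0 f; rewrite le_eqVlt => /predU1P[f0|f0].
  exists (add_path G); split=> //; apply: path_trivial => //.
  by rewrite add_path_end.
exists (flip (pf_end f) \o add_path G); split.
- apply: bij_comp => //; exact: inv_bij (flipK f0).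
- move=> x y; rewrite -[RHS]dG /=; move: (add_path G x) (add_path G y) => {}x {}y.
  exact: (lipschitz_cancel (flipK f0) (flip_lipschitz f0) (flip_lipschitz f0)).
- by rewrite /= Ef flip_zero_path.
Qed.

Lemma path_homogeneous : homogeneous (path_fun R).
Proof.
move=> x y; have [phi [bphi dphi phix]] := path_to_root x.
have [psi [[psi' K K'] dpsi psiy]] := path_to_root y.
exists (psi' \o phi); split.
- by apply: bij_comp => //; exists psi.
- by move=> a b; rewrite -dpsi /= !K' dphi.
- by rewrite /= phix -psiy K.
Qed.

End homogeneity.

(** * The hyperbolic plane *)

Section half_plane.
Context {R : realType}.
Implicit Types s t a b u v : R.

(* The Cayley transform [(1 - w) / (1 + w)] of the point
   [w = expR t + 'i a] of the right half-plane. *)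
Definition cayley t a : R[i] :=
  let u := expR t in let D := (1 + u) ^+ 2 + a ^+ 2 in
  Complex ((1 - u ^+ 2 - a ^+ 2) / D) (- (2 * a) / D).

Let D_gt0 t a : 0 < (1 + expR t) ^+ 2 + a ^+ 2.
Proof. by rewrite ltr_wpDr ?sqr_ge0 // exprn_gt0 // addr_gt0 ?expR_gt0. Qed.

Lemma cayley_lt1 t a : normc (cayley t a) < 1.
Proof.
rewrite /normc /cayley /= -[ltRHS]sqrtr1; have := D_gt0 t a; have := expR_gt0 t.
move: (expR t) => u u0 D0; rewrite ltr_sqrt //.
set D := (1 + u) ^+ 2 + a ^+ 2 in D0 *.
rewrite (_ : _ ^+ 2 + _ = 1 - 4 * u / D); last first.
  rewrite /D.
  by field; rewrite gt_eqF.
by rewrite ltrBlDr ltrDl divr_gt0 // mulr_gt0.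
Qed.

Definition half_plane_point t a : hyp_plane R := HypPlane (cayley_lt1 t a).

(** The Cayley transform brings the same factor [4 / (D * E)] into both squared moduli, and it
    cancels in the quotient. Since [P2 - Q2 = 4 * u * v], the quotient is
    [(P + Q) ^+ 2 / (4 * (u * v))]. *)
Lemma hyp_dist_half_plane s t a b :
  mdist (half_plane_point s a) (half_plane_point t b) =
  2 * ln (Num.sqrt ((expR s + expR t) ^+ 2 + (a - b) ^+ 2) +
          Num.sqrt ((expR s - expR t) ^+ 2 + (a - b) ^+ 2)) - ln 4 - s - t.
Proof.
rewrite -[X in _ - X - _](expRK s) -[X in _ - _ - X](expRK t).
rewrite /mdist /= /hyp_dist /= /cayley.
have := D_gt0 s a; have := D_gt0 t b; have := expR_gt0 s; have := expR_gt0 t.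
move: (expR s) (expR t) => u v v0 u0 E0 D0.
set D := _ + a ^+ 2 in D0 *; set E := _ + b ^+ 2 in E0 *.
set P2 := (u + v) ^+ 2 + _; set Q2 := (u - v) ^+ 2 + _.
have Q2_ge0 : 0 <= Q2 by rewrite addr_ge0 ?sqr_ge0.
have PQ : P2 - Q2 = 4 * u * v by rewrite /P2 /Q2; ring.
have uv0 : 0 < u * v by rewrite mulr_gt0.
have P2_gt0 : 0 < P2 by lra.
pose K := Num.sqrt (4 / (D * E)).
have c0 : 0 < 4 / (D * E) by rewrite divr_gt0 ?mulr_gt0.
have K0 : 0 < K by rewrite sqrtr_gt0.
set A2 := (1 - _) ^+ 2 + (0 - _) ^+ 2; set B2 := (_ - _) ^+ 2 + (_ / D - _) ^+ 2.
have -> : A2 = 4 / (D * E) * P2.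
  by rewrite /A2 /P2 /D /E; field; rewrite !gt_eqF.
have -> : B2 = 4 / (D * E) * Q2.
  by rewrite /B2 /Q2 /D /E; field; rewrite !gt_eqF.
rewrite !(sqrtrM _ (ltW c0)) -/K.
have := sqr_sqrtr (ltW P2_gt0); have := sqr_sqrtr Q2_ge0.
have := sqrtr_gt0 P2; rewrite P2_gt0; have := sqrtr_ge0 Q2.
have : Num.sqrt Q2 < Num.sqrt P2 by rewrite ltr_sqrt //; lra.
move: (Num.sqrt P2) (Num.sqrt Q2) => P Q QP Q0 P0 EQ EP.
have S0 : 0 < P + Q by lra.
have -> : (K * P + K * Q) / (K * P - K * Q) = (P + Q) ^+ 2 / (4 * (u * v)).
  have -> : 4 * (u * v) = (P + Q) * (P - Q).
    by rewrite mulrA -PQ -EP -EQ; ring.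
  have S1 : 0 < P - Q by lra.
  rewrite -mulrDr -mulrBr; field; rewrite !gt_eqF //.
rewrite ln_div ?posrE ?exprn_gt0 ?mulr_gt0 // lnXn // !lnM ?posrE ?mulr_gt0 //.
by rewrite mulr_natl; ring.
Qed.

Lemma hyp_plane_diameter : diameter (hyp_plane R) = +oo%E.
Proof.
apply/eqyP => A A0; apply: ereal_sup_ubound.
(* The points [expR (- A)] and 1 of the real axis are at distance exactly [A]. *)
exists (half_plane_point (- A) 0, half_plane_point 0 0) => //=.
congr (_%:E); rewrite hyp_dist_half_plane subrr expr0n /= !addr0 expR0.
have e1 : expR (- A) < 1 by rewrite expR_lt1 oppr_lt0.
have e0 := expR_gt0 (- A).
rewrite !sqrtr_sqr ger0_norm; last lra.
rewrite ltr0_norm; last lra.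
have -> : expR (- A) + 1 - (expR (- A) - 1) = 2 by ring.
have -> : (4 : R) = 2 ^+ 2 by ring.
by rewrite lnXn //; ring.
Qed.

End half_plane.

(** * Signed sums of distinct powers of 2 *)

Section ternary.
Context {R : realDomainType} (d : nat -> R).
Hypothesis d_ternary : forall k, [\/ d k = -1, d k = 0 | d k = 1].

Lemma ternary_sum_lt m : `|\sum_(k < m) 2 ^+ k * d k| < 2 ^+ m.
Proof.
elim: m => [|m IH]; first by rewrite big_ord0 normr0.
rewrite big_ord_recr /=; apply: le_lt_trans (ler_normD _ _) _.
have : `|2 ^+ m * d m| <= 2 ^+ m.
  rewrite normrM ger0_norm ?exprn_ge0 // ler_piMr ?exprn_ge0 //.
  by case: (d_ternary m) => ->; rewrite ?normrN ?normr0 ?normr1.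
by rewrite exprS; lra.
Qed.

(** The nonzero term of highest index outweighs the sum of all lower ones. *)
Lemma ternary_sum_neq0 m j : (j < m)%N -> d j != 0 ->
  \sum_(k < m) 2 ^+ k * d k != 0.
Proof.
move=> jm dj; elim: m jm => [//|m IH]; rewrite ltnS leq_eqVlt big_ord_recr /=.
have [dm|dm _] := eqVneq (d m) 0.
  rewrite dm mulr0 addr0 => /predU1P[jm|]; last exact: IH.
  by rewrite jm dm eqxx in dj.
have := ternary_sum_lt m; apply: contraTneq => /eqP.
rewrite addr_eq0 => /eqP ->; rewrite -leNgt normrN normrM ger0_norm ?exprn_ge0 //.
by case: (d_ternary m) dm => ->; rewrite ?eqxx // ?normrN normr1 mulr1.
Qed.

End ternary.

(** * Paths embedded at infinity into the hyperbolic plane *)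

Section subcone.
Context {R : realType}.
Implicit Types (f g : path_fun R) (a b s : R) (i : nat).

Lemma cvg_expR_decay a : 0 <= a ->
  expR (- (i.+1%:R * a)) @[i --> \oo] --> ((a == 0)%:R : R).
Proof.
rewrite le_eqVlt => /predU1P[<-|a0].
  rewrite eqxx; under eq_fun do rewrite mulr0 oppr0 expR0; exact: cvg_cst.
rewrite gt_eqF //.
have H : `|expR (- a)| < 1.
  by rewrite ger0_norm ?expR_ge0 // expR_lt1 oppr_lt0.
have := cvg_expr H; rewrite -(cvg_shiftS (GRing.exp (expR (- a)))) => K.
by apply: cvg_trans K; under eq_fun do rewrite -mulrN expRM_natl.
Qed.

Section finite_family.
Variables (m : nat) (A : nat -> path_fun R).

(* Two paths with separation time [s] get angles at distance about
   [expR (- i.+1 * s)]: powers of 2 prevent cancellation. *)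
Definition angle i f : R :=
  \sum_(k < m) 2 ^+ k * expR (- (i.+1%:R * segregation f (A k))).

Definition cone_point f i : hyp_plane R :=
  half_plane_point (- (i.+1%:R * pf_end f)) (angle i f).

(** Limit of the [k]-th term of the rescaled difference of angles, up to the factor [2 ^+ k]. If
    [A k] leaves [f] before [s], it leaves [g] at the same time and the exponentials cancel;
    otherwise an exponential survives only where [A k] leaves at exactly [s]. *)
Definition angle_coef f g k : R :=
  let s := segregation f g in
  if segregation f (A k) < s then 0
  else (segregation f (A k) == s)%:R - (segregation g (A k) == s)%:R.

Lemma angle_coef_ternary f g k :
  [\/ angle_coef f g k = -1, angle_coef f g k = 0 | angle_coef f g k = 1].
Proof.
rewrite /angle_coef; case: ifP => _; first by constructor 2.
case: eqP => _; case: eqP => _ /=; rewrite ?subrr ?subr0 ?sub0r;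
  [by constructor 2|by constructor 3|by constructor 1|by constructor 2].
Qed.

Lemma cvg_angle f g :
  expR (i.+1%:R * segregation f g) * (angle i f - angle i g) @[i --> \oo] -->
  (\sum_(k < m) 2 ^+ k * angle_coef f g k : R).
Proof.
set s := segregation f g.
have -> : (fun i => expR (i.+1%:R * s) * (angle i f - angle i g)) =
    (fun i => \sum_(k < m) 2 ^+ k *
      (expR (- (i.+1%:R * (segregation f (A k) - s))) -
       expR (- (i.+1%:R * (segregation g (A k) - s))))).
  apply/funext => i; rewrite /angle -sumrB mulr_sumr; apply: eq_bigr => k _.
  rewrite -mulrBr mulrCA mulrBr -!expRD.
  by congr (_ * (expR _ - expR _)); ring.
apply: cvg_big => [|k _]; first exact: add_continuous.
apply: cvgMr; rewrite /angle_coef -/s.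
have t1 := segregation_triangle g f (A k).
have t2 := segregation_triangle f g (A k).
rewrite (segregationC g f) -/s !ge_min in t1 t2.
case: ltP => fs.
  have -> : segregation g (A k) = segregation f (A k).
    by case/orP: t1; case/orP: t2; lra.
  by under eq_fun do rewrite subrr; exact: cvg_cst.
have gs : s <= segregation g (A k) by case/orP: t2; lra.
apply: cvgB; rewrite -subr_eq0; apply: cvg_expR_decay; rewrite subr_ge0 //.
Qed.

(** Pulling [expR (- (n i * s))] out of the square roots leaves the main term [n i * mdist f g] and
    [2 * ln (L i) - ln 4]. As [L] has a positive limit, the latter is bounded and disappears after
    division by [n i]. *)
Lemma cvg_cone_dist f g j : (j < m)%N -> A j = f ->
  i.+1%:R^-1 * mdist (cone_point f i) (cone_point g i) @[i --> \oo] -->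
  (mdist f g : R).
Proof.
move=> jm Aj; set s := segregation f g.
have sf : s <= pf_end f := segregation_lel f g.
have sg : s <= pf_end g := segregation_ler f g.
pose n i : R := i.+1%:R.
pose U i : R := expR (- (n i * (pf_end f - s))).
pose V i : R := expR (- (n i * (pf_end g - s))).
pose W i : R := expR (n i * s) * (angle i f - angle i g).
pose L i := Num.sqrt ((U i + V i) ^+ 2 + W i ^+ 2) +
            Num.sqrt ((U i - V i) ^+ 2 + W i ^+ 2).
have E : (fun i => i.+1%:R^-1 * mdist (cone_point f i) (cone_point g i)) =
         (fun i => mdist f g + (n i)^-1 * (2 * ln (L i) - ln 4)).
  apply/funext => i; rewrite hyp_dist_half_plane -/(n i) mdist_pathE -/s.
  have n0 : 0 < n i by [].
  have Lp : 0 < L i.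
    rewrite ltr_wpDr ?sqrtr_ge0 // sqrtr_gt0 ltr_wpDr ?sqr_ge0 //.
    by rewrite exprn_gt0 // addr_gt0 ?expR_gt0.
  set P := Num.sqrt _ + Num.sqrt _.
  have -> : P = expR (- (n i * s)) * L i.
    have H x : Num.sqrt ((expR (- (n i * s))) ^+ 2 * x) =
        expR (- (n i * s)) * Num.sqrt x.
      by rewrite sqrtrM ?sqr_ge0 // sqrtr_sqr ger0_norm ?expR_ge0.
    have EU : expR (- (n i * pf_end f)) = expR (- (n i * s)) * U i.
      by rewrite -expRD; congr expR; ring.
    have EV : expR (- (n i * pf_end g)) = expR (- (n i * s)) * V i.
      by rewrite -expRD; congr expR; ring.
    have EW : angle i f - angle i g = expR (- (n i * s)) * W i.
      by rewrite mulrA -expRD addNr expR0 mul1r.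
    by rewrite /P EU EV EW mulrDr -!H; congr (Num.sqrt _ + Num.sqrt _); ring.
  rewrite lnM ?posrE ?expR_gt0 // expRK; field.
  by rewrite gt_eqF.
rewrite {}E -[X in _ --> X]addr0; apply: cvgD; first exact: cvg_cst.
pose D := \sum_(k < m) 2 ^+ k * angle_coef f g k.
pose u : R := (pf_end f - s == 0)%:R; pose v : R := (pf_end g - s == 0)%:R.
have cU : U i @[i --> \oo] --> u by apply: cvg_expR_decay; rewrite subr_ge0.
have cV : V i @[i --> \oo] --> v by apply: cvg_expR_decay; rewrite subr_ge0.
have cW : W i @[i --> \oo] --> D by exact: cvg_angle.
pose l := Num.sqrt ((u + v) ^+ 2 + D ^+ 2) + Num.sqrt ((u - v) ^+ 2 + D ^+ 2).
have cL : L i @[i --> \oo] --> l.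
  apply: cvgD; apply: (@continuous_cvg _ _ _ _ _ _ (@Num.sqrt R));
    try exact: sqrt_continuous.
    by rewrite !expr2; apply: cvgD; apply: cvgM => //; exact: cvgD.
  by rewrite !expr2; apply: cvgD; apply: cvgM => //; exact: cvgB.
have l0 : 0 < l.
  rewrite ltr_wpDr ?sqrtr_ge0 // sqrtr_gt0.
  have u0 : 0 <= u by []. have v0 : 0 <= v by [].
  (* If one path ends at [s], then [u] or [v] is 1. Otherwise [A j = f] has coefficient -1 in [D],
     which is therefore a nonzero ternary sum. *)
  have [uv|uv] := boolP ((pf_end f - s == 0) || (pf_end g - s == 0)).
    rewrite ltr_wpDr ?sqr_ge0 // exprn_gt0 // /u /v.
    by case/orP: uv => ->; [rewrite ltr_wpDr|rewrite ltr_wpDl].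
  rewrite ltr_wpDl ?sqr_ge0 // exprn_even_gt0 //=.
  apply: (@ternary_sum_neq0 _ _ (angle_coef_ternary f g) _ j) => //.
  rewrite /angle_coef -/s Aj segregationxx ltNge sf /= segregationC -/s eqxx.
  move: uv; rewrite negb_or !subr_eq0 => /andP[/negbTE -> _].
  by rewrite eq_sym oner_eq0.
rewrite -(mul0r (2 * ln l - ln 4)); apply: cvgM; first exact: cvg_harmonic.
apply: cvgB; last exact: cvg_cst.
apply: cvgM; first exact: cvg_cst.
by apply: (@continuous_cvg _ _ _ _ _ _ (@ln R)) => //; exact: continuous_ln.
Qed.

End finite_family.

Lemma path_asymptotic_subcone :
  asymptotic_subcone (path_fun R) (hyp_plane R).
Proof.
split; [exact: hyp_plane_diameter|exact: path_geodesic_space|].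
move=> A /finite_seqP[l ->]; exists (fun i => i.+1%:R^-1); split.
- by move=> i; rewrite invr_gt0.
- exact: cvg_harmonic.
exists (cone_point (size l) (nth root_path l)) => f g fl gl.
apply: (@cvg_cone_dist _ _ _ _ (index f l)); first by rewrite index_mem.
exact: nth_index.
Qed.

End subcone.

Theorem theorem1p9 (R : realType) :
  [/\ real_tree (path_fun R), thick (path_fun R), homogeneous (path_fun R) &
      asymptotic_subcone (path_fun R) (hyp_plane R)].
Proof.
split.
- exact: path_real_tree.
- exact: path_thick.
- exact: path_homogeneous.
- exact: path_asymptotic_subcone.
Qed.
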